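(* Let $\lambda_w\in\operatorname{End}(\mathcal{O}_2)$ (with $w\in\mathcal{U}(\mathcal{O}_2)$) be extendable. Suppose one of the following conditions holds: (1) $\lambda_w(\mathcal{F}_2)\subseteq\mathcal{F}_2$; (2) there exists a unital $C^*$-subalgebra $B\subseteq\lambda_w(\mathcal{O}_2)$ containing $\lambda_w(s_1^ns_1^{*n})$ for all $n\ge 1$, together with a faithful conditional expectation $\mathcal{E}:\mathcal{Q}_2\to B$. Then $\lambda_w$ admits a unique extension to an endomorphism of $\mathcal{Q}_2$.
   Context: The 2-adic ring $C^*$-algebra $\mathcal{Q}_2$ is the universal unital $C^*$-algebra generated by a unitary $u$ and an isometry $s_2$ with $s_2u=u^2s_2$ and $s_2s_2^*+us_2s_2^*u^*=1$. Put $s_1:=us_2$; then $\mathcal{O}_2:=C^*(s_1,s_2)\subseteq\mathcal{Q}_2$ is the canonical copy of the Cuntz algebra. For $t\in\mathbb{T}$ the gauge automorphism $\alpha_t$ of $\mathcal{Q}_2$ is given by $\alpha_t(u)=u$, $\alpha_t(s_2)=ts_2$; $\mathcal{F}_2$ is the fixed-point algebra of the gauge action restricted to $\mathcal{O}_2$. Endomorphisms are unital $*$-endomorphisms. For $w\in\mathcal{U}(\mathcal{O}_2)$ (the unitary group), $\lambda_w\in\operatorname{End}(\mathcal{O}_2)$ is determined by $\lambda_w(s_i)=ws_i$ ($i=1,2$). $\lambda_w$ is extendable if some element of $\operatorname{End}(\mathcal{Q}_2)$ restricts to $\lambda_w$ on $\mathcal{O}_2$; any such element is called an extension of $\lambda_w$.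 *)

(* Defs.v *)
From HB Require Import structures.
From mathcomp Require Import all_boot all_order all_algebra.
From mathcomp Require Import all_classical all_reals all_analysis.
From mathcomp Require Export complex.
Export numFieldNormedType.Exports.

Set Implicit Arguments.
Unset Strict Implicit.
Unset Printing Implicit Defensive.

Import Order.TTheory GRing.Theory Num.Theory.

Local Open Scope classical_set_scope.
Local Open Scope ring_scope.
Local Open Scope complex_scope.

(* A nonzero unital C*-algebra over the complex numbers R[i]: a Banach space
   with a product, a unit and an involution.  The norm of a normed module over
   R[i] takes its values in R[i]; the norm axioms force these values to be
   nonnegative reals.  [cs_oner_neq0], required by [algType], excludes exactly
   the zero algebra. *)
Record cstarType (R : realType) := CStarType {
  cs_space : completeNormedModType R[i];
  cs_one : cs_space;
  cs_mul : cs_space -> cs_space -> cs_space;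
  cs_star : cs_space -> cs_space;
  cs_mulA : associative cs_mul;
  cs_mul1l : left_id cs_one cs_mul;
  cs_mul1r : right_id cs_one cs_mul;
  cs_mulDl : left_distributive cs_mul +%R;
  cs_mulDr : right_distributive cs_mul +%R;
  cs_oner_neq0 : cs_one != 0;
  cs_scaleAl : forall (a : R[i]) x y, a *: cs_mul x y = cs_mul (a *: x) y;
  cs_scaleAr : forall (a : R[i]) x y, a *: cs_mul x y = cs_mul x (a *: y);
  cs_starD : forall x y, cs_star (x + y) = cs_star x + cs_star y;
  cs_starZ : forall (a : R[i]) x, cs_star (a *: x) = conjc a *: cs_star x;
  cs_starM : forall x y, cs_star (cs_mul x y) = cs_mul (cs_star y) (cs_star x);
  cs_starK : involutive cs_star;
  cs_normM : forall x y, `|cs_mul x y| <= `|x| * `|y|;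
  cs_norm_star : forall x, `|cs_mul (cs_star x) x| = `|x| ^+ 2
}.

(* The ring structure is attached to this alias because Hierarchy Builder
   rejects a structure joining rings and normed modules: [numDomainType]
   already inherits from both. *)
Definition cs_carrier (R : realType) (A : cstarType R) : Type := cs_space A.
Coercion cs_carrier : cstarType >-> Sortclass.

Section CStarInstances.
Variables (R : realType) (A : cstarType R).

HB.instance Definition _ :=
  CompleteNormedModule.copy (cs_carrier A) (cs_space A).
HB.instance Definition _ := GRing.Zmodule_isNzRing.Build (cs_carrier A)
  (@cs_mulA R A) (@cs_mul1l R A) (@cs_mul1r R A) (@cs_mulDl R A)
  (@cs_mulDr R A) (@cs_oner_neq0 R A).
HB.instance Definition _ :=
  GRing.Lmodule_isLalgebra.Build R[i] (cs_carrier A) (@cs_scaleAl R A).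
HB.instance Definition _ :=
  GRing.Lalgebra_isAlgebra.Build R[i] (cs_carrier A) (@cs_scaleAr R A).

Definition star (x : A) : A := cs_star x.

End CStarInstances.

Section CStarDefs.
Variable R : realType.
Implicit Types A D : cstarType R.

Definition isometry_elt A (s : A) : Prop := star s * s = 1.

Definition unitary A (u : A) : Prop := star u * u = 1 /\ u * star u = 1.

Definition positive_elt A (x : A) : Prop := exists y : A, x = star y * y.

(* Unital C*-subalgebra, with the unit of the ambient algebra. *)
Record cstar_subalg A (B : set A) : Prop := CStarSubalg {
  subalg_closed_norm : closed B;
  subalg1 : B 1;
  subalgD : forall x y, B x -> B y -> B (x + y);
  subalgZ : forall (a : R[i]) x, B x -> B (a *: x);
  subalgM : forall x y, B x -> B y -> B (x * y);
  subalg_star : forall x, B x -> B (star x)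
}.

Definition cstar_gen A (S : set A) : set A :=
  [set x | forall B : set A, cstar_subalg B -> S `<=` B -> B x].

(* f restricts to a unital *-homomorphism from B to the algebra D;
   the values of f outside B are irrelevant. *)
Record star_hom_on A D (B : set A) (f : A -> D) : Prop := StarHomOn {
  star_hom1 : f 1 = 1;
  star_homD : forall x y, B x -> B y -> f (x + y) = f x + f y;
  star_homZ : forall (a : R[i]) x, B x -> f (a *: x) = a *: f x;
  star_homM : forall x y, B x -> B y -> f (x * y) = f x * f y;
  star_hom_star : forall x, B x -> f (star x) = star (f x)
}.

Definition star_hom A D (f : A -> D) : Prop := star_hom_on setT f.

Definition star_endo_on A (B : set A) (f : A -> A) : Prop :=
  star_hom_on B f /\ (forall x, B x -> B (f x)).

Definition star_endo A (f : A -> A) : Prop := star_endo_on setT f.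

Definition star_auto A (f : A -> A) : Prop := star_endo f /\ bijective f.

Record cond_expectation A (B : set A) (E : A -> A) : Prop := CondExpectation {
  cond_exp_in : forall x, B (E x);
  cond_expD : forall x y, E (x + y) = E x + E y;
  cond_expZ : forall (a : R[i]) x, E (a *: x) = a *: E x;
  cond_exp_id : forall b, B b -> E b = b;
  cond_exp_contractive : forall x, `|E x| <= `|x|;
  cond_exp_pos : forall x, positive_elt x -> positive_elt (E x);
  cond_exp_bimod : forall b x b', B b -> B b' -> E (b * x * b') = b * E x * b'
}.

Definition faithful A (E : A -> A) : Prop :=
  forall x, positive_elt x -> E x = 0 -> x = 0.

Definition Q2_relations A (u s2 : A) : Prop :=
  [/\ unitary u, isometry_elt s2, s2 * u = u ^+ 2 * s2
    & s2 * star s2 + u * s2 * star s2 * star u = 1].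

(* (Q, u, s2) is the universal unital C*-algebra with these generators and
   relations.  The induced homomorphism is unique because *-homomorphisms are
   continuous and u, s2 generate Q.  Omitting the zero algebra as a target
   loses nothing: every algebra has a unique homomorphism to it. *)
Record is_Q2 (Q : cstarType R) (u s2 : Q) : Prop := IsQ2 {
  Q2_rel : Q2_relations u s2;
  Q2_gen : cstar_gen [set u; s2] = setT;
  Q2_univ : forall (D : cstarType R) (v t : D), Q2_relations v t ->
    exists f : Q -> D, [/\ star_hom f, f u = v & f s2 = t]
}.

Section InQ2.
Variables (Q : cstarType R) (u s2 : Q).

Definition Q2_s1 : Q := u * s2.

Definition O2 : set Q := cstar_gen [set Q2_s1; s2].

(* When [is_Q2 u s2] holds, there is exactly one such alpha for each t of
   modulus 1. *)
Definition gauge_auto (t : R[i]) (alpha : Q -> Q) : Prop :=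
  [/\ star_auto alpha, alpha u = u & alpha s2 = t *: s2].

Definition F2 : set Q :=
  [set x | O2 x /\ forall (t : R[i]) (alpha : Q -> Q),
     `|t| = 1 -> gauge_auto t alpha -> alpha x = x].

(* lam is the endomorphism lambda_w of O2 (only its values on O2 matter). *)
Definition is_lambda (w : Q) (lam : Q -> Q) : Prop :=
  [/\ star_endo_on O2 lam, lam Q2_s1 = w * Q2_s1 & lam s2 = w * s2].

Definition is_extension (lam Phi : Q -> Q) : Prop :=
  star_endo Phi /\ (forall x, O2 x -> Phi x = lam x).

Definition extendable (lam : Q -> Q) : Prop :=
  exists Phi, is_extension lam Phi.

End InQ2.

End CStarDefs.

(* Main.v *)
Require Import Defs.
From mathcomp Require Import all_boot all_order all_algebra.
From mathcomp Require Import all_classical all_reals all_analysis.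
From mathcomp Require Import ring lra zify.

Set Implicit Arguments.
Unset Strict Implicit.
Unset Printing Implicit Defensive.

Import Order.TTheory GRing.Theory Num.Theory.

Local Open Scope classical_set_scope.
Local Open Scope ring_scope.

(* Let Phi, Psi be two extensions and d = Phi(u) - Psi(u).  With T_i = lam(s_i),
   the relations u s_2 = s_1 and u s_1 = s_2 u give d = T_2 d T_1^*, hence
   d P_n = d for all n, where P_n = T_1^n T_1^*^n.

   The key tool is a sequence of isometries W_m(X) which commute asymptotically
   with every element of Q_2, uniformly over all isometries X:
     W_m(X) = 2^-m sum_(k < 4^m) phi^k(A),
     A = 2^-2m sum_(i < 2^4m) u^i s_2^(4m) s_2^(4^m) s_1 X u^-i,
   where phi(x) = s_1 x s_1^* + s_2 x s_2^*.  The inner average almost commutes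
   with u and the outer one with s_2, because both commutators telescope.

   Under condition (2), e = E(d^* d) satisfies e P_n = e and lies in Phi(Q_2).
   Transporting W_m by Phi and taking X = T_2 one gets P_n W_m(T_2) = 0 for n
   large, so |e| = |W_m e| is as small as the commutator [e, W_m], and d = 0 by
   faithfulness.

   Under condition (1), P_n and T_1^(n-1) T_2 T_1^*^n lie in F_2, a limit of
   matrix algebras, so that P_n has normalised trace 2^-n.  Averaging
   |d|^2 = |d^* W^* W d| over X = s_mu with mu running through the words of length k,
   replacing W d by d W = d P_n W and letting k tend to infinity bounds |d| by
   a multiple of the square root of that trace. *)

(** * Real-valued norm and basic calculus in a C*-algebra *)

Section RealNorm.
Variables (R : realType) (A : cstarType R).
Implicit Types (x y z : A) (a : R[i]) (r : R).

(** The library norm takes values in [R[i]]; its real part lies in the totally ordered field [R],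
    where all estimates are made. *)
Definition nrm x : R := complex.Re `|x|.

Lemma nrmE x : (nrm x)%:C%C = `|x|.
Proof. by rewrite /nrm RRe_real // ger0_real. Qed.

Lemma nrm_ge0 x : 0 <= nrm x.
Proof. by rewrite -lecR nrmE normr_ge0. Qed.

Lemma nrm0 : nrm (0 : A) = 0.
Proof. by rewrite /nrm normr0. Qed.

Lemma nrm0_eq x : nrm x = 0 -> x = 0.
Proof. by move=> h; apply/normr0_eq0; rewrite -nrmE h. Qed.

Lemma nrmN x : nrm (- x) = nrm x.
Proof. by rewrite /nrm normrN. Qed.

Lemma nrm_distC x y : nrm (x - y) = nrm (y - x).
Proof. by rewrite -nrmN opprB. Qed.

Lemma nrmD x y : nrm (x + y) <= nrm x + nrm y.
Proof. by rewrite -lecR rmorphD /= !nrmE ler_normD. Qed.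

Lemma nrmB x y : nrm (x - y) <= nrm x + nrm y.
Proof. by rewrite -(nrmN y) nrmD. Qed.

Lemma nrm_dist_trans y x z : nrm (x - z) <= nrm (x - y) + nrm (y - z).
Proof. by rewrite -[x - z](subrKA y) nrmD. Qed.

Lemma nrmM x y : nrm (x * y) <= nrm x * nrm y.
Proof. by rewrite -lecR rmorphM /= !nrmE cs_normM. Qed.

Lemma nrm_cstar x : nrm (star x * x) = nrm x ^+ 2.
Proof. by apply: (@complexI R); rewrite rmorphXn /= !nrmE cs_norm_star. Qed.

Lemma nrmZ a x : nrm (a *: x) = complex.Re `|a| * nrm x.
Proof.
apply: (@complexI R); rewrite rmorphM !nrmE normrZ; congr (_ * _).
by apply/esym/RRe_real/ger0_real.
Qed.

Lemma nrmZr r x : 0 <= r -> nrm (r%:C%C *: x) = r * nrm x.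
Proof. by move=> r0; rewrite nrmZ ger0_norm ?ler0c. Qed.

Lemma starD x y : star (x + y) = star x + star y. Proof. exact: cs_starD. Qed.
Lemma starM x y : star (x * y) = star y * star x. Proof. exact: cs_starM. Qed.
Lemma starZ a x : star (a *: x) = conjc a *: star x. Proof. exact: cs_starZ. Qed.
Lemma starK : involutive (@star R A). Proof. exact: cs_starK. Qed.

Lemma star0 : star (0 : A) = 0.
Proof. by apply: (addrI (star 0)); rewrite -starD !addr0. Qed.

Lemma starN x : star (- x) = - star x.
Proof. by apply: (addrI (star x)); rewrite -starD !subrr star0. Qed.

Lemma starB x y : star (x - y) = star x - star y.
Proof. by rewrite starD starN. Qed.

Lemma star1 : star (1 : A) = 1.
Proof.
have h : star (star (1 : A) * 1) = star 1 * star (star 1) by rewrite starM.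
by move: h; rewrite mulr1 starK mulr1.
Qed.

Lemma starX x n : star (x ^+ n) = star x ^+ n.
Proof. by elim: n => [|n IH]; rewrite ?expr0 ?star1 // exprS exprSr starM IH. Qed.

Lemma star_sum (I : Type) (s : seq I) (P : pred I) (F : I -> A) :
  star (\sum_(i <- s | P i) F i) = \sum_(i <- s | P i) star (F i).
Proof. exact: (big_morph _ starD star0). Qed.

Lemma nrm_sum (I : Type) (s : seq I) (P : pred I) (F : I -> A) :
  nrm (\sum_(i <- s | P i) F i) <= \sum_(i <- s | P i) nrm (F i).
Proof.
elim/big_rec2: _ => [|i r x _ h]; first by rewrite nrm0.
by rewrite (le_trans (nrmD _ _)) // lerD2l.
Qed.

Lemma nrm_star x : nrm (star x) = nrm x.
Proof.
suff h y : nrm y <= nrm (star y).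
  by apply/le_anti/andP; split => //; rewrite -{2}(starK x).
have [->|y0] := eqVneq (nrm y) 0; first exact: nrm_ge0.
have : 0 < nrm y by rewrite lt_neqAle eq_sym y0 nrm_ge0.
move=> yp; rewrite -(ler_pM2r yp) -expr2 -nrm_cstar.
exact: nrmM.
Qed.

Lemma nrm1 : nrm (1 : A) = 1.
Proof.
have h : nrm (1 : A) ^+ 2 = nrm (1 : A).
  by rewrite -nrm_cstar star1 mul1r.
have /eqP : nrm (1 : A) * (nrm (1 : A) - 1) = 0.
  by rewrite mulrBr mulr1 -expr2 h subrr.
rewrite mulf_eq0 subr_eq0 => /orP[/eqP/nrm0_eq/eqP|/eqP //].
by rewrite oner_eq0.
Qed.

Lemma isometry_nrm s : @isometry_elt R A s -> nrm s = 1.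
Proof.
move=> h; apply/eqP; rewrite -(@eqrXn2 _ 2) // ?nrm_ge0 //.
by rewrite -nrm_cstar h nrm1 expr1n.
Qed.

Lemma isometryM s t : @isometry_elt R A s -> isometry_elt t -> isometry_elt (s * t).
Proof.
by rewrite /isometry_elt => hs ht; rewrite starM mulrA -(mulrA (star t)) hs mulr1.
Qed.

Lemma isometryX s n : @isometry_elt R A s -> isometry_elt (s ^+ n).
Proof.
move=> hs; elim: n => [|n IH]; first by rewrite expr0 /isometry_elt star1 mulr1.
by rewrite exprS; apply: isometryM.
Qed.

Lemma isometry_nrmM s x : isometry_elt s -> nrm (s * x) = nrm x.
Proof.
move=> hs; apply/eqP; rewrite -(@eqrXn2 _ 2) // ?nrm_ge0 //.
by rewrite -!nrm_cstar starM mulrA -(mulrA (star x)) hs mulr1.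
Qed.

Lemma nrmM_le1l s x : nrm s <= 1 -> nrm (s * x) <= nrm x.
Proof.
by move=> h; rewrite (le_trans (nrmM _ _)) // ler_piMl // nrm_ge0.
Qed.

Lemma nrmM_le1r s x : nrm s <= 1 -> nrm (x * s) <= nrm x.
Proof.
by move=> h; rewrite (le_trans (nrmM _ _)) // ler_piMr // nrm_ge0.
Qed.

Lemma closed_nrm (C : set A) :
  (forall x, (forall e : R, 0 < e -> exists2 y, C y & nrm (x - y) <= e) -> C x) ->
  closed C.
Proof.
move=> h x clx; apply: h => e e0.
have /clx [y [Cy]] : nbhs x (ball x e%:C%C) by apply: nbhsx_ballx; rewrite ltcR.
rewrite -ball_normE /= -nrmE ltcR => /ltW; by exists y.
Qed.

(** Completeness of the algebra enters here: increments bounded by a geometric series give a Cauchy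
    sequence. *)
Lemma geometric_cvg (x : nat -> A) (q : R) : 0 <= q < 1 ->
  (forall n, nrm (x n.+1 - x n) <= q ^+ n) ->
  exists l, forall e : R, 0 < e -> exists N, forall n, (N <= n)%N -> nrm (x n - l) <= e.
Proof.
move=> /andP[q0 q1] hx.
have q1' : 0 < 1 - q by rewrite subr_gt0.
have dist n m : nrm (x (n + m)%N - x n) <= q ^+ n / (1 - q).
  have : nrm (x (n + m)%N - x n) <= q ^+ n * (1 - q ^+ m) / (1 - q).
    elim: m => [|m IH].
      by rewrite addn0 subrr nrm0 expr0 subrr mulr0 mul0r.
    rewrite addnS (le_trans (nrm_dist_trans (x (n + m)%N) _ _)) //.
    apply: (le_trans (lerD (hx _) IH)).
    rewrite exprD exprS le_eqVlt; apply/orP; left; apply/eqP.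
    have : 1 - q != 0 by rewrite gt_eqF.
    move: (q ^+ n) (q ^+ m) => a b ?; by field.
  move=> /le_trans; apply; rewrite ler_pM2r ?invr_gt0 //.
  by rewrite ler_piMr ?exprn_ge0 // gerBl exprn_ge0.
have tends e : 0 < e -> exists N, forall n, (N <= n)%N -> q ^+ n / (1 - q) <= e.
  move=> e0; have e1 : 0 < e * (1 - q) by rewrite mulr_gt0.
  have qc : q ^+ n @[n --> \oo] --> (0 : R) by apply: cvg_expr; rewrite ger0_norm.
  have [N _ hN] : \forall n \near \oo, `|0 - q ^+ n| <= e * (1 - q).
    by move/cvgrPdist_le : qc; apply.
  exists N => n /hN /=; rewrite sub0r normrN ger0_norm ?exprn_ge0 //.
  by rewrite ler_pdivrMr.
have cx : cvg (x n @[n --> \oo]).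
  apply/cauchy_cvgP/cauchyP => e e0.
  have {}e0 : 0 < complex.Re e /\ e = (complex.Re e)%:C%C.
    by move: e0; rewrite ltcE /= => /andP[/eqP h1 h2]; split => //; case: e h1 {h2} => a b /= ->.
  move: e0; move: (complex.Re e) => {}r [r0 ->].
  have [N hN] := tends (r / 2) ltac:(lra).
  exists (x N), N => // n /= Nn; rewrite -ball_normE /= -nrmE ltcR.
  rewrite nrm_distC -(subnKC Nn) (le_lt_trans (dist _ _)) //.
  by rewrite (le_lt_trans (hN _ (leqnn _))) //; lra.
exists (lim (x n @[n --> \oo])) => e e0.
have [N _ hN] : \forall n \near \oo, `|lim (x n @[n --> \oo]) - x n| <= e%:C%C.
  by move/cvgrPdist_le : cx; apply; rewrite ltcR.
by exists N => n /hN /=; rewrite -nrmE lecR nrm_distC.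
Qed.

End RealNorm.

(** * Generated subalgebras, and self-adjoint elements as averages of unitaries *)

Section Subalgebras.
Variables (R : realType) (A : cstarType R).
Implicit Types (x y z : A) (a : R[i]).

Lemma le_mul_eps (c d K : R) : 0 <= K ->
  (forall e, 0 < e -> c <= d + K * e) -> c <= d.
Proof.
move=> K0 h; apply/ler_addgt0Pr => e e0.
have [K00|Kn] := eqVneq K 0.
  by rewrite (le_trans (h e e0)) // K00 mul0r addr0 lerDl ltW.
have Kp : 0 < K by rewrite lt_neqAle eq_sym Kn.
by rewrite (le_trans (h (e / K) (divr_gt0 e0 Kp))) // mulrC divfK.
Qed.

Lemma nrm_eps_eq0 (K : R) x : 0 <= K ->
  (forall e, 0 < e -> nrm x <= K * e) -> x = 0.
Proof.
move=> K0 h; apply/nrm0_eq/le_anti; rewrite nrm_ge0 andbT.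
by apply: (@le_mul_eps _ _ K) => // e /h; rewrite add0r.
Qed.

Lemma cstar_gen_ind (S C : set A) :
  C 1 -> (forall x y, C x -> C y -> C (x + y)) ->
  (forall a x, C x -> C (a *: x)) ->
  (forall x y, C x -> C y -> C (x * y)) ->
  (forall x, C x -> C (star x)) ->
  (forall x, (forall e : R, 0 < e -> exists2 y, C y & nrm (x - y) <= e) -> C x) ->
  S `<=` C -> cstar_gen S `<=` C.
Proof.
move=> h1 hD hZ hM hS hC SC x; apply => //.
by split => //; apply: closed_nrm.
Qed.

Lemma cstar_gen_sub (S : set A) x : S x -> cstar_gen S x.
Proof. by move=> Sx B _; apply. Qed.

Lemma cstar_gen1 (S : set A) : cstar_gen S 1.
Proof. by move=> B /subalg1. Qed.

Lemma cstar_genM (S : set A) x y :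
  cstar_gen S x -> cstar_gen S y -> cstar_gen S (x * y).
Proof. by move=> hx hy B hB SB; apply: subalgM => //; [exact: hx | exact: hy]. Qed.

Lemma cstar_genX (S : set A) x n : cstar_gen S x -> cstar_gen S (x ^+ n).
Proof.
move=> hx; elim: n => [|n IH]; first exact: cstar_gen1.
by rewrite exprS; apply: cstar_genM.
Qed.

Lemma cstar_gen_star (S : set A) x : cstar_gen S x -> cstar_gen S (star x).
Proof. by move=> hx B hB SB; apply: subalg_star => //; exact: hx. Qed.

(** The unitary is [x + i c] with [c] a self-adjoint square root of [1 - x^2] commuting with [x].
    The root comes from an iteration, which takes the place of functional calculus. *)
Lemma unitary_decomposition x : star x = x -> nrm x < 1 ->
  exists2 v : A, unitary v & x = 2^-1 *: (v + star v).
Proof.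
move=> sx; set k := nrm x => k1; have k0 : 0 <= k := nrm_ge0 x.
pose h : R[i] := 2^-1.
have h2 y : h *: (y + y) = y.
  by rewrite -[y]scale1r -scalerDl scalerA mulVf // pnatr_eq0.
have hn y : nrm (h *: y) = nrm y / 2.
  have -> : h = (2^-1 : R)%:C%C by rewrite /h fmorphV rmorph_nat.
  by rewrite nrmZr ?invr_ge0 // mulrC.
have hh : conjc h = h by rewrite /h conjc_inv conjc_nat.
(* A fixed point [b] of [b |-> (x^2 + b^2) / 2] satisfies [(1 - b)^2 = 1 - x^2],
   so that [x + i (1 - b)] is unitary. *)
pose F (b : A) := h *: (x * x + b * b).
pose b n := iter n F 0.
have bP n : [/\ nrm (b n) <= k, star (b n) = b n & x * b n = b n * x].
  elim: n => [|n [b1 b2 b3]]; first by rewrite /= nrm0 star0 mulr0 mul0r.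
  rewrite /= -/(b n); split.
  - rewrite hn; have := nrmD (x * x) (b n * b n); have := nrmM x x.
    have := nrmM (b n) (b n); rewrite -/k.
    have : nrm (b n) * nrm (b n) <= k * k by apply: ler_pM; rewrite ?nrm_ge0.
    have : k * k <= k by rewrite ler_piMr // ltW.
    by lra.
  - by rewrite starZ hh starD !starM sx b2.
  - by rewrite -scalerAr -scalerAl mulrDr mulrDl !mulrA b3 -(mulrA (b n)) b3 mulrA.
(* The identity [y^2 - z^2 = y (y - z) + (y - z) z] needs no commutation, so [F] contracts the ball
   of radius [k] by the factor [k]. *)
have Fdiff y z : nrm y <= k -> nrm z <= k -> nrm (F y - F z) <= k * nrm (y - z).
  move=> hy hz.
  have -> : F y - F z = h *: (y * (y - z) + (y - z) * z).
    rewrite /F -scalerBr; congr (_ *: _).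
    by rewrite mulrBr mulrBl opprD addrACA subrr add0r addrA subrK.
  rewrite hn; have := nrmD (y * (y - z)) ((y - z) * z).
  have := nrmM y (y - z); have := nrmM (y - z) z.
  have : nrm y * nrm (y - z) <= k * nrm (y - z) by apply: ler_wpM2r; rewrite ?nrm_ge0.
  have : nrm (y - z) * nrm z <= k * nrm (y - z).
    by rewrite mulrC; apply: ler_wpM2r; rewrite ?nrm_ge0.
  by lra.
have bdiff n : nrm (b n.+1 - b n) <= k ^+ n.
  elim: n => [|n IH].
    rewrite /= subr0 /F mulr0 addr0 hn expr0; have := nrmM x x; rewrite -/k.
    have : k * k <= k by rewrite ler_piMr // ltW.
    by lra.
  rewrite exprS; have [b1 _ _] := bP n; have [b2 _ _] := bP n.+1.
  by rewrite (le_trans (Fdiff _ _ b2 b1)) // ler_wpM2l.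
have [l hl] := geometric_cvg (introT andP (conj k0 k1)) bdiff.
have near_l e : 0 < e -> exists n, nrm (b n - l) <= e /\ nrm (b n.+1 - l) <= e.
  by move=> /hl[N hN]; exists N; split; apply: hN.
have lk : nrm l <= k.
  apply: (@le_mul_eps _ _ 1) => // e /near_l[n [h1 _]]; have [b1 _ _] := bP n.
  have := nrmB (b n) (b n - l); rewrite subKr.
  lra.
have sl : star l = l.
  apply/eqP; rewrite -subr_eq0; apply/eqP/(@nrm_eps_eq0 2) => // e /near_l[n [h1 _]].
  have [_ b2 _] := bP n.
  have := nrm_dist_trans (b n) (star l) l.
  rewrite -{1}b2 -starB nrm_star (nrm_distC l (b n)); lra.
have cl : x * l = l * x.
  apply/eqP; rewrite -subr_eq0; apply/eqP/(@nrm_eps_eq0 2) => // e /near_l[n [h1 _]].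
  have [_ _ b3] := bP n.
  have -> : x * l - l * x = (b n - l) * x - x * (b n - l).
    by rewrite mulrBl mulrBr b3 opprB [RHS]addrC subrKA.
  have := nrmB ((b n - l) * x) (x * (b n - l)).
  have := nrmM_le1r (b n - l) (ltW k1); have := nrmM_le1l (b n - l) (ltW k1).
  lra.
have Fl : F l = l.
  apply/eqP; rewrite -subr_eq0; apply/eqP/(@nrm_eps_eq0 2) => // e /near_l[n [h1 h2']].
  have [b1 _ _] := bP n.
  have d1 : nrm (F l - b n.+1) <= k * nrm (l - b n) by apply: Fdiff.
  have d2 : k * nrm (l - b n) <= nrm (b n - l).
    by rewrite (nrm_distC l) ler_piMl ?nrm_ge0 // ltW.
  have := nrm_dist_trans (b n.+1) (F l) l; lra.
pose c := 1 - l.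
have cx : c * x = x * c by rewrite /c mulrBl mulrBr mul1r mulr1 cl.
have cc : x * x + c * c = 1.
  have : F l + F l = x * x + l * l by rewrite /F -scalerDr h2.
  rewrite Fl => hll; rewrite /c mulrBl mul1r mulrBr mulr1 opprB.
  by rewrite (addrC _ (l * l - l)) !addrA -hll addrK addrAC subrr add0r.
have sc : star c = c by rewrite /c starB star1 sl.
have ii : conjc ('i%C : R[i]) = - 'i%C by apply/eqP; rewrite eq_complex /= oppr0 !eqxx.
have i2 : 'i%C * 'i%C = -1 :> R[i] by rewrite -expr2 sqr_i.
have sv : star (x + 'i%C *: c) = x - 'i%C *: c by rewrite starD starZ sx sc ii scaleNr.
have comm : (x - 'i%C *: c) * (x + 'i%C *: c) = 1.
  rewrite mulrBl !mulrDr -!scalerAl -!scalerAr scalerA i2 cx scaleN1r.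
  by rewrite opprB addrACA subrr addr0 cc.
exists (x + 'i%C *: c).
  split; rewrite sv //.
  rewrite mulrDl !mulrBr -!scalerAl -!scalerAr scalerA i2 cx scaleN1r opprK.
  by rewrite subrKA cc.
by rewrite sv addrACA subrr addr0 h2.
Qed.

End Subalgebras.

(** * Contractivity and uniqueness of *-homomorphisms *)

Section StarHom.
Variables (R : realType) (A D : cstarType R) (f : A -> D).
Hypothesis hf : star_hom f.

Lemma shom1 : f 1 = 1. Proof. exact: star_hom1 hf. Qed.
Lemma shomD x y : f (x + y) = f x + f y. Proof. exact: (star_homD hf). Qed.
Lemma shomZ (a : R[i]) x : f (a *: x) = a *: f x. Proof. exact: (star_homZ hf). Qed.
Lemma shomM x y : f (x * y) = f x * f y. Proof. exact: (star_homM hf). Qed.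
Lemma shomS x : f (star x) = star (f x). Proof. exact: (star_hom_star hf). Qed.

Lemma shom0 : f 0 = 0.
Proof. by rewrite -(scale0r 0) shomZ scale0r. Qed.

Lemma shomB x y : f (x - y) = f x - f y.
Proof. by rewrite -scaleN1r shomD shomZ scaleN1r. Qed.

Lemma shomX x n : f (x ^+ n) = f x ^+ n.
Proof. by elim: n => [|n IH]; rewrite ?expr0 ?shom1 // !exprS shomM IH. Qed.

(* Averages of two unitaries are contractions, and unitaries go to unitaries. *)
Lemma shom_contractive x : nrm (f x) <= nrm x.
Proof.
have sa y : star y = y -> nrm (f y) <= nrm y.
  move=> sy; apply: (@le_mul_eps R _ _ 1) => // e e0; rewrite mul1r.
  have r0 : 0 < nrm y + e by have := nrm_ge0 y; lra.
  pose z := ((nrm y + e)^-1)%:C%C *: y.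
  have yz : y = (nrm y + e)%:C%C *: z.
    by rewrite /z scalerA -rmorphM mulfV ?gt_eqF // scale1r.
  have sz : star z = z by rewrite starZ conjc_real sy.
  have nz : nrm z < 1.
    rewrite nrmZr ?invr_ge0 ?ltW // mulrC ltr_pdivrMr //; lra.
  have [v [uv1 uv2] zv] := unitary_decomposition sz nz.
  have nv : nrm (f v) = 1.
    by apply: isometry_nrm; rewrite /isometry_elt -shomS -shomM uv1 shom1.
  have fz : nrm (f z) <= 1.
    rewrite zv shomZ shomD shomS.
    have -> : 2^-1 = (2^-1 : R)%:C%C :> R[i] by rewrite fmorphV rmorph_nat.
    rewrite nrmZr ?invr_ge0 //; have := nrmD (f v) (star (f v)).
    by rewrite nrm_star nv; lra.
  rewrite [in leLHS]yz shomZ nrmZr ?(ltW r0) //.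
  by rewrite ler_piMr // ltW.
(* The C*-identity reduces the general case to the self-adjoint element [star x * x]. *)
rewrite -(@ler_pXn2r _ 2) ?nnegrE ?nrm_ge0 //.
by rewrite -!nrm_cstar -shomS -shomM; apply: sa; rewrite starM starK.
Qed.

End StarHom.

Lemma star_hom_comp (R : realType) (A B C : cstarType R) (f : A -> B) (g : B -> C) :
  star_hom f -> star_hom g -> star_hom (g \o f).
Proof.
move=> hf hg; split => /=; first by rewrite (shom1 hf) (shom1 hg).
- by move=> x y _ _; rewrite (shomD hf) (shomD hg).
- by move=> a x _; rewrite (shomZ hf) (shomZ hg).
- by move=> x y _ _; rewrite (shomM hf) (shomM hg).
- by move=> x _; rewrite (shomS hf) (shomS hg).
Qed.

(** The set where [f] and [g] agree is a *-subalgebra, and it is closed because both maps are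
    contractive. *)
Lemma star_hom_eq_gen (R : realType) (A D : cstarType R) (S : set A) (f g : A -> D) :
  star_hom f -> star_hom g -> cstar_gen S = setT ->
  (forall x, S x -> f x = g x) -> f = g.
Proof.
move=> hf hg genS fg; apply/funext => x.
have : cstar_gen S x by rewrite genS.
apply: (@cstar_gen_ind _ _ S (fun x => f x = g x)) => //.
- by rewrite (shom1 hf) (shom1 hg).
- by move=> y z; rewrite (shomD hf) (shomD hg) => -> ->.
- by move=> a y; rewrite (shomZ hf) (shomZ hg) => ->.
- by move=> y z; rewrite (shomM hf) (shomM hg) => -> ->.
- by move=> y; rewrite (shomS hf) (shomS hg) => ->.
move=> y h; apply/eqP; rewrite -subr_eq0; apply/eqP.
apply: (@nrm_eps_eq0 _ _ 2) => // e /h[z fgz yz].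
have := nrm_dist_trans (f z) (f y) (g y).
have := shom_contractive hf (y - z); have := shom_contractive hg (z - y).
by rewrite (shomB hf) (shomB hg) -fgz (nrm_distC z); lra.
Qed.

(** * Cuntz pairs, the canonical shift and words *)

Section CuntzPair.
Variables (R : realType) (A : cstarType R).

(** The relations of the Cuntz algebra, stated for any pair because they are needed both for the
    generators and for their images under an endomorphism. *)
Record cuntz_pair (s1 s2 : A) : Prop := CuntzPair {
  cp11 : star s1 * s1 = 1;
  cp22 : star s2 * s2 = 1;
  cp12 : star s1 * s2 = 0;
  cp21 : star s2 * s1 = 0;
  cp_sum : s1 * star s1 + s2 * star s2 = 1
}.

Variables s1 s2 : A.
Hypothesis hs : cuntz_pair s1 s2.
Implicit Types (x y z : A) (w : seq bool).

(** The canonical endomorphism [phi] of the Cuntz algebra, defined on all of [A]. *)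
Definition cshift x : A := s1 * x * star s1 + s2 * x * star s2.

Lemma shift_s1 x : cshift x * s1 = s1 * x.
Proof. by rewrite mulrDl -!mulrA (cp11 hs) (cp21 hs) !mulr0 addr0 mulr1. Qed.

Lemma shift_s2 x : cshift x * s2 = s2 * x.
Proof. by rewrite mulrDl -!mulrA (cp12 hs) (cp22 hs) !mulr0 add0r mulr1. Qed.

Lemma s2S_shift x : star s2 * cshift x = x * star s2.
Proof. by rewrite mulrDr !mulrA (cp21 hs) (cp22 hs) !mul0r add0r mul1r. Qed.

Lemma shift_star_hom : star_hom cshift.
Proof.
split.
- by rewrite /cshift !mulr1 (cp_sum hs).
- by move=> x y _ _; rewrite /cshift !mulrDr !mulrDl addrACA.
- by move=> a x _; rewrite /cshift -!scalerAr -!scalerAl -scalerDr.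
- move=> x y _ _; rewrite /(cshift y) mulrDr !mulrA shift_s1 shift_s2.
  by rewrite /cshift -!mulrA.
- by move=> x _; rewrite /cshift starD !starM !starK !mulrA.
Qed.

Lemma iter_cshift_star_hom n : star_hom (iter n cshift).
Proof.
elim: n => [|n IH]; first by split.
exact: star_hom_comp IH shift_star_hom.
Qed.

Definition ltr b : A := if b then s1 else s2.

Fixpoint word w : A := if w is b :: v then ltr b * word v else 1.

Lemma word_cat v w : word (v ++ w) = word v * word w.
Proof. by elim: v => [|b v IH] /=; rewrite ?mul1r // IH mulrA. Qed.

Lemma ltrS_ltr b c : star (ltr b) * ltr c = (b == c)%:R.
Proof.
by case: b; case: c; rewrite /= ?(cp11 hs) ?(cp12 hs) ?(cp21 hs) ?(cp22 hs).
Qed.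

Lemma word_isometry w : isometry_elt (word w).
Proof.
elim: w => [|b w IH]; first by rewrite /isometry_elt star1 mulr1.
by apply: isometryM => //; rewrite /isometry_elt ltrS_ltr eqxx.
Qed.

Lemma wordS_word v w : size v = size w -> star (word v) * word w = (v == w)%:R.
Proof.
elim: v w => [|b v IH] [|c w] //=; first by rewrite star1 mulr1.
case=> /IH h; rewrite starM mulrA -(mulrA (star _)) ltrS_ltr eqseq_cons.
by case: (b == c); rewrite /= ?mulr1 ?mulr0 ?mul0r ?h.
Qed.

Lemma shift_ltr x b : cshift x * ltr b = ltr b * x.
Proof. by case: b; rewrite ?shift_s1 ?shift_s2. Qed.

Lemma iter_cshift_word n x w : size w = n -> iter n cshift x * word w = word w * x.
Proof.
elim: n w => [|n IH] [|b w] //=; first by rewrite mulr1 mul1r.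
by case=> /IH h; rewrite mulrA shift_ltr -mulrA h mulrA.
Qed.

Lemma s2XS_iter_shift n x : star s2 ^+ n * iter n cshift x = x * star s2 ^+ n.
Proof.
elim: n => [|n IH]; first by rewrite expr0 mulr1 mul1r.
by rewrite iterS exprSr -mulrA s2S_shift mulrA IH -mulrA -exprSr.
Qed.

End CuntzPair.

(** * Powers of [u] and binary words *)

Section AsymptoticallyCentral.
Variables (R : realType) (A : cstarType R) (u s2 s1 : A).
Hypotheses (hus : Q2_relations u s2) (s1E : s1 = u * s2).
Implicit Types (x y z X Y : A).

Let uSu : star u * u = 1. Proof. by case: hus => [[]]. Qed.
Let uuS : u * star u = 1. Proof. by case: hus => [[]]. Qed.
Let s2u : s2 * u = u ^+ 2 * s2. Proof. by case: hus. Qed.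
Let s2S : star s2 * s2 = 1. Proof. by case: hus. Qed.

Lemma Q2_cuntz : cuntz_pair s1 s2.
Proof.
have e1 : s1 * star s1 + s2 * star s2 = 1.
  by case: hus => _ _ _ <-; rewrite addrC s1E starM !mulrA.
have i1 : star s1 * s1 = 1.
  by rewrite s1E starM mulrA -(mulrA (star s2)) uSu mulr1.
have e21 : star s2 * s1 = 0.
  (* Each of the two terms on the left equals [star s2 * s1], so this element is equal to its
     double. *)
  have : star s2 * (s1 * star s1 + s2 * star s2) * s1 = star s2 * s1.
    by rewrite e1 mulr1.
  rewrite mulrDr mulrDl !mulrA s2S mul1r -(mulrA _ (star s1)) i1 mulr1.
  by move/eqP; rewrite -subr_eq0 addrK => /eqP.
split => //; last by apply: (can_inj (@starK R A)); rewrite starM starK e21 star0.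
Qed.
Let hs := Q2_cuntz.

Lemma u_s1 : u * s1 = s2 * u.
Proof. by rewrite s2u s1E mulrA expr2. Qed.

Lemma s1S_u : star s1 * u = star s2.
Proof. by rewrite s1E starM -mulrA uSu mulr1. Qed.

Lemma s2S_u : star s2 * u = u * star s1.
Proof.
rewrite -[u in LHS]mulr1 -(cp_sum hs) mulrDr mulrDr !mulrA.
rewrite -(mulrA _ u s1) u_s1 mulrA s2S mul1r -(mulrA _ u s2) -s1E.
by rewrite (cp21 hs) mul0r addr0.
Qed.

Lemma uX_s2 n : u ^+ (2 * n) * s2 = s2 * u ^+ n.
Proof.
elim: n => [|n IH]; first by rewrite muln0 !expr0 mul1r mulr1.
by rewrite mulnS exprD -mulrA IH mulrA -s2u -mulrA -exprS.
Qed.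

(** Since [u^2 s2 = s2 u], the word spells the [l] binary digits of [i], least significant first,
    with [s1] for the digit 1. *)
Lemma uX_s2X_word l i : (i < 2 ^ l)%N ->
  exists2 w, size w = l & u ^+ i * s2 ^+ l = word s1 s2 w.
Proof.
elim: l i => [|l IH] i; first by case: i => // _; exists [::]; rewrite ?expr0 ?mulr1.
move=> il; have /IH[w sw ew] : (i./2 < 2 ^ l)%N by rewrite expnS in il; lia.
exists (odd i :: w); rewrite /= ?sw // -ew.
rewrite -{1}(odd_double_half i) exprD exprS mulrA -mul2n -(mulrA (_ ^+ odd i)) uX_s2.
rewrite !mulrA; congr (_ * _ * _).
by case: (odd i); rewrite ?expr1 ?expr0 ?mul1r.
Qed.

(** After cancelling [u^i], the power [n = j - i] is read digit by digit: an even [n] is halved by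
    one pair [star s2], [s2], while an odd one produces [star s2 * s1 = 0]. As [0 < n < 2^l], an odd
    digit is met. *)
Lemma uX_s2X_orth l i j : (i < j < 2 ^ l)%N ->
  star (u ^+ i * s2 ^+ l) * (u ^+ j * s2 ^+ l) = 0.
Proof.
have key n : (0 < n < 2 ^ l)%N -> star s2 ^+ l * u ^+ n * s2 ^+ l = 0.
  elim: l n => [|l IH] n; first by rewrite expn0; lia.
  rewrite expnS => hn; rewrite exprSr exprS.
  have -> : star s2 ^+ l * star s2 * u ^+ n * (s2 * s2 ^+ l) =
            star s2 ^+ l * (star s2 * (u ^+ n * s2)) * s2 ^+ l by rewrite !mulrA.
  rewrite -{1}(odd_double_half n) addnC exprD -mul2n.
  case on : (odd n).
    rewrite expr1 -(mulrA (u ^+ (2 * _)) u) -s1E.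
    have -> : star s2 * (u ^+ (2 * n./2) * s1) = 0; last by rewrite mulr0 mul0r.
    have h : star s2 * u ^+ (2 * n./2) = u ^+ n./2 * star s2.
      elim: (n./2) => [|k IHk]; first by rewrite muln0 !expr0 mul1r mulr1.
      rewrite mulnS exprD expr2 !mulrA s2S_u -(mulrA u) s1S_u -mulrA IHk.
      by rewrite mulrA -exprS.
    by rewrite mulrA h -mulrA (cp21 hs) mulr0.
  rewrite expr0 mulr1 uX_s2 (mulrA (star s2)) s2S mul1r IH //.
  by have := odd_double_half n; rewrite on -mul2n; lia.
move=> hij; rewrite starM !starX -mulrA (mulrA (star u ^+ i)).
rewrite -(subnKC (ltnW (proj1 (andP hij)))) exprD (mulrA (star u ^+ i)).
have -> : star u ^+ i * u ^+ i = 1.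
  elim: (i) => [|k IH]; first by rewrite !expr0 mulr1.
  by rewrite exprSr exprS -mulrA (mulrA (star u)) uSu mul1r IH.
by rewrite mul1r mulrA key //; lia.
Qed.


(** * The isometries [W_m(X)] and their commutators with the generators *)

Definition half_pow n : R[i] := ((2^-1 : R) ^+ n)%:C%C.

Lemma half_pow_conj n : conjc (half_pow n) = half_pow n.
Proof. exact: conjc_real. Qed.

Lemma half_pow_sqr n : half_pow n * half_pow n * (2 ^ (2 * n))%:R = 1.
Proof.
rewrite -rmorphM -exprD addnn -mul2n natrX.
have -> : (2 : R[i]) = (2 : R)%:C%C by rewrite rmorph_nat.
by rewrite -rmorphXn -rmorphM -exprMn mulVf ?expr1n ?pnatr_eq0.
Qed.

Lemma nrm_half_pow n x : nrm (half_pow n *: x) = 2^-1 ^+ n * nrm x.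
Proof. by rewrite nrmZr // exprn_ge0 // invr_ge0. Qed.

(* Averaging over conjugates by powers of [u] makes the commutator with [u]
   telescope; the [2^l] terms have orthogonal ranges because of [s2^l]. *)
Definition u_avg n Y : A := let l := (2 * n)%N in
  half_pow n *: \sum_(0 <= i < 2 ^ l) u ^+ i * s2 ^+ l * (Y * star u ^+ i).

(* Ranges starting with [2^K 1] at different depths [<= K] are orthogonal, so the
   shifts of [u_avg _ (marker K * X)] can be summed to an isometry. *)
Definition marker K : A := s2 ^+ K * s1.

(** This is [W_m(X)]. The inner parameter is [2 * m] because the outer sum multiplies commutators
    with [u] by up to [4^m * 2^-m = 2^m]; an inner bound of order [4^-m] leaves one of order
    [2^-m]. *)
Definition central_isom m X : A :=
  half_pow m *: \sum_(0 <= k < 2 ^ (2 * m))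
    iter k (cshift s1 s2) (u_avg (2 * m) (marker (2 ^ (2 * m)) * X)).

(** The cross terms vanish and the [4^n] diagonal terms are 1, which the squared factor [2^-n]
    normalises. Doubling the exponent avoids a square root of 2. *)
Lemma sum_orth_isometry n (F : nat -> A) :
  (forall i, (i < 2 ^ (2 * n))%N -> isometry_elt (F i)) ->
  (forall i j, (i < j < 2 ^ (2 * n))%N -> star (F i) * F j = 0) ->
  isometry_elt (half_pow n *: \sum_(0 <= i < 2 ^ (2 * n)) F i).
Proof.
move=> iF oF; rewrite /isometry_elt starZ half_pow_conj -scalerAl -scalerAr scalerA.
rewrite star_sum big_distrl /= -[RHS]scale1r -(half_pow_sqr n) -[RHS]scalerA.
congr (_ *: _); rewrite scaler_nat -[in RHS](subn0 (2 ^ _)%N) -sumr_const_nat.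
apply: eq_big_nat => i /andP[_ il].
rewrite big_distrr /= (bigD1_seq i) ?mem_index_iota ?il ?iota_uniq //= iF //.
rewrite big1_seq ?addr0 // => j; rewrite mem_index_iota => /andP[ij /andP[_ jl]].
have [ji|ij'|ij'] := ltngtP i j; last by rewrite ij' eqxx in ij.
  by rewrite oF // ji.
by apply: (can_inj (@starK R A)); rewrite starM starK oF ?star0 // ij'.
Qed.

Lemma u_avg_isometry n Y : isometry_elt Y -> isometry_elt (u_avg n Y).
Proof.
move=> hY; have uu i : isometry_elt (star u ^+ i).
  by apply: isometryX; rewrite /isometry_elt starK.
apply: sum_orth_isometry => [i il|i j hij].
  by do 2![apply: isometryM => //]; apply: isometryX.
by rewrite starM -mulrA (mulrA (star (u ^+ i * _))) uX_s2X_orth // mul0r mulr0.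
Qed.

Lemma marker_isometry K : isometry_elt (marker K).
Proof. by apply: isometryM; [apply: isometryX | exact: cp11 hs]. Qed.

(** Moving [star s2 ^+ d] through the shift and cancelling powers of [s2] leaves the factor
    [star s1 * s2 ^+ d], zero for [d > 0]. *)
Lemma marker_orth K d : (0 < d <= K)%N ->
  star (marker K) * iter d (cshift s1 s2) (marker K * star (marker K)) = 0.
Proof.
case/andP => d0 dK; rewrite {1}/marker starM starX.
rewrite -{1}(subnK dK) exprD -!mulrA (s2XS_iter_shift hs).
have -> : s2 ^+ K = s2 ^+ (K - d) * s2 ^+ d by rewrite -exprD subnK.
rewrite !mulrA -(mulrA (star s1)) -starX (isometryX _ s2S) mulr1.
by case: d d0 {dK} => // d _; rewrite exprS mulrA (cp12 hs) !mul0r.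
Qed.

(** Every summand begins with a word of length [2 * n], through which the shifted [x] passes to
    reach [X]. *)
Lemma iter_cshift_u_avg n x X : x * X = X ->
  iter (2 * n) (cshift s1 s2) x * u_avg n X = u_avg n X.
Proof.
move=> xX; rewrite /u_avg -scalerAr big_distrr /=; congr (_ *: _).
apply: eq_big_nat => i /andP[_ /uX_s2X_word[w sw ->]].
rewrite (mulrA (iter _ _ _)).
by rewrite (iter_cshift_word hs) // -mulrA (mulrA x) xX.
Qed.

(** Only the orthogonality of the shifts of [B] is at stake. The range of [B] lies under a shift of
    the marker projection [q], and [q] is orthogonal to its own shifts by [1] to [K]. *)
Lemma central_isom_isometry m X : isometry_elt X -> isometry_elt (central_isom m X).
Proof.
move=> hX; set K := (2 ^ (2 * m))%N.
set B := u_avg (2 * m) (marker K * X).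
have hB : isometry_elt B.
  by apply/u_avg_isometry/isometryM => //; exact: marker_isometry.
have sh n := iter_cshift_star_hom hs n.
have hB' d : (0 < d <= K)%N -> star B * iter d (cshift s1 s2) B = 0.
  move=> dK; set q := marker K * star (marker K).
  have sq : star q = q by rewrite starM starK.
  have qB : iter (2 * (2 * m)) (cshift s1 s2) q * B = B.
    by apply: iter_cshift_u_avg; rewrite mulrA -(mulrA (marker K)) marker_isometry mulr1.
  rewrite -{1}qB -{2}qB starM -(shomS (sh _)) sq (shomM (sh _)) -mulrA.
  rewrite (mulrA (iter _ _ q)) -iterD addnC iterD -(shomM (sh _)) /q.
  by rewrite -(mulrA (marker K)) marker_orth // mulr0 (shom0 (sh _)) mul0r mulr0.
apply: sum_orth_isometry => [i _|i j /andP[ij jK]].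
  by rewrite /isometry_elt -(shomS (sh _)) -(shomM (sh _)) hB (shom1 (sh _)).
rewrite -(subnKC (ltnW ij)) iterD -(shomS (sh _)) -(shomM (sh _)) hB' ?(shom0 (sh _)) //.
by rewrite /K; lia.
Qed.

Lemma u_avg_comm n Y : isometry_elt Y ->
  nrm (u * u_avg n Y - u_avg n Y * u) <= 2 * 2^-1 ^+ n.
Proof.
move=> hY; set l := (2 * n)%N.
(* [g i] is the [i]-th summand times [u] on the right, and [g i.+1] is the same summand times [u] on
   the left. *)
pose g i := u ^+ i * s2 ^+ l * Y * star u ^+ i * u.
have ng i : nrm (g i) = 1.
  have uu : isometry_elt (star u) by rewrite /isometry_elt starK.
  apply/isometry_nrm/(isometryM _ uSu)/(isometryM _ (isometryX _ uu))/(isometryM _ hY).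
  by apply: isometryM; apply: isometryX.
have -> : u * u_avg n Y - u_avg n Y * u = half_pow n *: (g (2 ^ l)%N - g 0%N).
  rewrite /u_avg -scalerAr -scalerAl -scalerBr; congr (_ *: _).
  rewrite big_distrr big_distrl /= -sumrB -(telescope_sumr _ (leq0n _)).
  by apply: eq_bigr => i _; rewrite /g (exprS u) (exprSr (star u)) -!mulrA uSu mulr1.
by rewrite nrm_half_pow mulrC ler_pM2r ?exprn_gt0 ?invr_gt0 // (le_trans (nrmB _ _)) // !ng.
Qed.

(** Both products contain [s1 * x * star s2]. Once it cancels, the commutator of the shift is that
    of [x] placed between [s2] and [star s1]. *)
Lemma shift_comm_u x :
  nrm (u * cshift s1 s2 x - cshift s1 s2 x * u) <= nrm (u * x - x * u).
Proof.
have s1Su := s1S_u; have s2Su := s2S_u; have us1 := u_s1.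
have -> : u * cshift s1 s2 x - cshift s1 s2 x * u = s2 * (u * x - x * u) * star s1.
  rewrite /cshift mulrDr mulrDl !mulrA us1 -s1E -!(mulrA _ _ u) s1Su s2Su.
  by rewrite opprD addrA addrK mulrBr mulrBl !mulrA.
have n1 : nrm (star s1) = 1 by rewrite nrm_star; apply/isometry_nrm/(cp11 hs).
by rewrite (le_trans (nrmM_le1r _ _)) ?n1 // isometry_nrmM.
Qed.

Lemma central_isom_comm m X : isometry_elt X ->
  let W := central_isom m X in
  [/\ nrm (u * W - W * u) <= 2 * 2^-1 ^+ m,
      nrm (s2 * W - W * s2) <= 2 * 2^-1 ^+ m
    & nrm (star s2 * W - W * star s2) <= 2 * 2^-1 ^+ m].
Proof.
move=> hX; rewrite /central_isom; set K := (2 ^ (2 * m))%N.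
set B := u_avg (2 * m) (marker K * X).
have hY : isometry_elt (marker K * X) by apply/isometryM => //; exact: marker_isometry.
pose b k := iter k (cshift s1 s2) B.
have nb k : nrm (b k) = 1.
  apply: isometry_nrm; have sh := iter_cshift_star_hom hs k.
  by rewrite /isometry_elt -(shomS sh) -(shomM sh) u_avg_isometry // (shom1 sh).
rewrite -/(b _).
have comm y : y * (half_pow m *: \sum_(0 <= k < K) b k) -
    (half_pow m *: \sum_(0 <= k < K) b k) * y =
    half_pow m *: \sum_(0 <= k < K) (y * b k - b k * y).
  by rewrite -scalerAr -scalerAl -scalerBr big_distrr big_distrl -sumrB.
have p0 : 0 < 2^-1 ^+ m :> R by rewrite exprn_gt0 ?invr_gt0.
split; rewrite comm nrm_half_pow.
- rewrite mulrC ler_pM2r // (le_trans (nrm_sum _ _ _)) //.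
  have hb k : nrm (u * b k - b k * u) <= 2 * 2^-1 ^+ (2 * m).
    by elim: k => [|k IH]; [exact: u_avg_comm | exact: le_trans (shift_comm_u _) IH].
  rewrite (le_trans (ler_sum_nat (fun k _ => hb k))) // sumr_const_nat subn0.
  rewrite -[_ *+ K]mulr_natr -mulrA /K.
 by rewrite natrX -exprMn mulVf ?pnatr_eq0 // expr1n mulr1.
- rewrite mulrC ler_pM2r //.
  (* The sum telescopes because [s2 * b k = b k.+1 * s2]. *)
  have -> : \sum_(0 <= k < K) (s2 * b k - b k * s2) = (b K - b 0%N) * s2.
    rewrite -(telescope_sumr _ (leq0n _)) big_distrl /=; apply: eq_bigr => k _.
    by rewrite mulrBl /b /= (shift_s2 hs).
  by rewrite (le_trans (nrmM_le1r _ _)) ?(isometry_nrm s2S) // (le_trans (nrmB _ _)) // !nb.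
rewrite mulrC ler_pM2r //.
have -> : \sum_(0 <= k < K) (star s2 * b k - b k * star s2) = star s2 * (b 0%N - b K).
  rewrite -opprB -(telescope_sumr _ (leq0n _)) mulrN big_distrr /= -sumrN.
  apply: eq_bigr => k _.
  by rewrite mulrBr opprB /b /= (s2S_shift hs).
rewrite (le_trans (nrmM_le1l _ _)) ?nrm_star ?(isometry_nrm s2S) //.
by rewrite (le_trans (nrmB _ _)) // !nb.
Qed.

(** The threshold [m0] is independent of [X]: the trace argument takes for [X] words whose length is
    chosen after [m]. *)
Definition asym_central y := forall e : R, 0 < e -> exists m0, forall m X,
  (m0 <= m)%N -> isometry_elt X ->
  nrm (y * central_isom m X - central_isom m X * y) <= e.

Lemma half_pow_small (e : R) : 0 < e ->
  exists m0, forall m, (m0 <= m)%N -> 2 * 2^-1 ^+ m <= e.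
Proof.
move=> e0; have qc : (2^-1 : R) ^+ n @[n --> \oo] --> (0 : R).
  by apply: cvg_expr; rewrite ger0_norm ?invr_ge0 // invf_lt1 ?ltr1n.
have [N _ hN] : \forall n \near \oo, `|0 - (2^-1 : R) ^+ n| <= e / 2.
  by move/cvgrPdist_le : qc; apply; rewrite divr_gt0.
exists N => m /hN /=; rewrite sub0r normrN ger0_norm ?exprn_ge0 ?invr_ge0 //; lra.
Qed.

Lemma asym_central_of_bound y :
  (forall m X, isometry_elt X ->
    nrm (y * central_isom m X - central_isom m X * y) <= 2 * 2^-1 ^+ m) ->
  asym_central y.
Proof.
move=> h e /half_pow_small[m0 hm]; exists m0 => m X m0m hX.
exact: le_trans (h m X hX) (hm m m0m).
Qed.

Lemma asym_centralD x y : asym_central x -> asym_central y -> asym_central (x + y).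
Proof.
move=> hx hy e e0; have e2 : 0 < e / 2 by rewrite divr_gt0.
have [m1 h1] := hx _ e2; have [m2 h2] := hy _ e2.
exists (maxn m1 m2) => m X; rewrite geq_max => /andP[l1 l2] hX.
rewrite mulrDl mulrDr opprD addrACA (le_trans (nrmD _ _)) //.
by have := h1 m X l1 hX; have := h2 m X l2 hX; lra.
Qed.

Lemma asym_centralM x y : asym_central x -> asym_central y -> asym_central (x * y).
Proof.
move=> hx hy e e0; set K := nrm x + nrm y + 1.
have K0 : 0 < K by rewrite /K; have := nrm_ge0 x; have := nrm_ge0 y; lra.
have eK : 0 < e / K by rewrite divr_gt0.
have [m1 h1] := hx _ eK; have [m2 h2] := hy _ eK.
exists (maxn m1 m2) => m X; rewrite geq_max => /andP[l1 l2] hX.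
set W := central_isom m X.
have -> : x * y * W - W * (x * y) = x * (y * W - W * y) + (x * W - W * x) * y.
  by rewrite mulrBr mulrBl !mulrA subrKA.
have {}h1 := h1 m X l1 hX; have {}h2 := h2 m X l2 hX.
have b1 : nrm (x * (y * W - W * y)) <= nrm x * (e / K).
  by rewrite (le_trans (nrmM _ _)) // ler_wpM2l ?nrm_ge0.
have b2 : nrm ((x * W - W * x) * y) <= (e / K) * nrm y.
  by rewrite (le_trans (nrmM _ _)) // ler_wpM2r ?nrm_ge0.
have : K * (e / K) = e by rewrite mulrC divfK // gt_eqF.
by have := nrmD (x * (y * W - W * y)) ((x * W - W * x) * y); rewrite /K; nra.
Qed.

Lemma asym_centralZ (a : R[i]) x : asym_central x -> asym_central (a *: x).
Proof.
move=> hx; have h1 : asym_central (a *: 1).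
  move=> e e0; exists 0%N => m X _ _; move: (central_isom m X) => W.
  by rewrite -scalerAl -scalerAr mul1r mulr1 subrr nrm0 ltW.
by rewrite -[x]mul1r scalerAl; apply: asym_centralM.
Qed.

(** Asymptotic centrality is not visibly stable under [star], as [W] is only an isometry, so the
    induction carries [x] and [star x] together. A general [f] covers both the identity and an
    extension [Phi]. *)
Lemma asym_central_hom (Q : cstarType R) (f : Q -> A) (v t x : Q) :
  star_hom f -> f v = u -> f t = s2 ->
  cstar_gen [set v; t] x -> asym_central (f x).
Proof.
move=> hf fv ft; pose C (x : Q) := asym_central (f x) /\ asym_central (f (star x)).
suff h : cstar_gen [set v; t] `<=` C by move=> /h[].
have c1 : asym_central 1.
  by move=> e e0; exists 0%N => m X _ hX; rewrite mul1r mulr1 subrr nrm0 ltW.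
apply: cstar_gen_ind => {x}.
- by rewrite /C star1 (shom1 hf).
- move=> x y [x1 x2] [y1 y2]; split; rewrite ?starD (shomD hf); exact: asym_centralD.
- by move=> a x [x1 x2]; split; rewrite ?starZ (shomZ hf); apply: asym_centralZ.
- move=> x y [x1 x2] [y1 y2]; split; rewrite ?starM (shomM hf); exact: asym_centralM.
- by move=> x [x1 x2]; split; rewrite ?starK.
- move=> x hx; have appr (y z : Q) : asym_central (f z) ->
    forall e : R, nrm (y - z) <= e -> 0 < e ->
    exists m0, forall m X, (m0 <= m)%N -> isometry_elt X ->
      nrm (f y * central_isom m X - central_isom m X * f y) <= 3 * e.
    move=> hz e yz e0; have [m0 h0] := hz e e0; exists m0 => m X m0m hX.
    set W := central_isom m X; have nW : nrm W <= 1.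
      by rewrite isometry_nrm //; apply: central_isom_isometry.
    have -> : f y * W - W * f y = f (y - z) * W - W * f (y - z) + (f z * W - W * f z).
      by rewrite (shomB hf) mulrBl mulrBr opprB -[RHS]addrA [X in _ = _ + X]addrC !subrKA.
    have := nrmD (f (y - z) * W - W * f (y - z)) (f z * W - W * f z).
    have := nrmB (f (y - z) * W) (W * f (y - z)).
    have := nrmM_le1l (f (y - z)) nW; have := nrmM_le1r (f (y - z)) nW.
    have := shom_contractive hf (y - z); have := h0 m X m0m hX; rewrite -/W.
    by lra.
  split=> e e0; have e3 : 0 < e / 3 by [rewrite divr_gt0];
    have [z [z1 z2] xz] := hx _ e3; have e33 : 3 * (e / 3) = e by [field].
    by have := appr x z z1 _ xz e3; rewrite e33.
  have := appr (star x) (star z) z2 (e / 3); rewrite -starB nrm_star e33; exact.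
move=> x [->|->]; split; rewrite ?(shomS hf) ?fv ?ft; apply: asym_central_of_bound;
  move=> m X hX; have [h1 h2 h3] := central_isom_comm m hX => //.
set W := central_isom m X.
have -> : star u * W - W * star u = - (star u * (u * W - W * u) * star u).
  rewrite mulrBr mulrBl !mulrA uSu mul1r -(mulrA _ u) uuS mulr1.
  by rewrite opprB.
have nu : nrm (star u) <= 1 by rewrite nrm_star (isometry_nrm uSu).
by rewrite nrmN (le_trans (nrmM_le1r _ nu)) // (le_trans (nrmM_le1l _ nu)).
Qed.

(** The list serves all [X] at once, so the words in front of [X] have bounded length once [m] is
    fixed. *)
Lemma central_isom_words m : exists l : seq (seq bool * A), forall X,
  central_isom m X = \sum_(p <- l) word s1 s2 p.1 * X * p.2.
Proof.
pose wf (f : A -> A) := exists l : seq (seq bool * A), forall X,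
  f X = \sum_(p <- l) word s1 s2 p.1 * X * p.2.
have wf_sum n (f : nat -> A -> A) : (forall i, (i < n)%N -> wf (f i)) ->
    wf (fun X => \sum_(0 <= i < n) f i X).
  elim: n => [|n IH] h; first by exists [::] => X; rewrite !big_nil.
  have [|l hl] := IH; first by move=> i il; apply: h; exact: ltnW.
  have [l' hl'] := h n (ltnSn n); exists (l ++ l') => X.
  by rewrite big_nat_recr //= hl hl' big_cat.
have wfZ a f : wf f -> wf (fun X => a *: f X).
  move=> [l hl]; exists [seq (p.1, a *: p.2) | p <- l] => X.
  by rewrite hl big_map scaler_sumr; apply: eq_bigr => p _ /=; rewrite scalerAr.
have wf_shift k f : wf f -> wf (fun X => iter k (cshift s1 s2) (f X)).
  move=> hf; elim: k => // k [l hl].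
  exists ([seq (true :: p.1, p.2 * star s1) | p <- l] ++
          [seq (false :: p.1, p.2 * star s2) | p <- l]) => X.
  rewrite iterS hl big_cat !big_map /= /cshift !big_distrr !big_distrl /=.
  by congr (_ + _); apply: eq_bigr => p _; rewrite !mulrA.
apply/wfZ/wf_sum => k _; apply/wf_shift/wfZ/wf_sum => i /uX_s2X_word[w _ ->].
have [v _ ev] : exists2 v, size v = (2 ^ (2 * m))%N & s2 ^+ (2 ^ (2 * m)) = word s1 s2 v.
  move: (2 ^ (2 * m))%N => n; exists (nseq n false); first exact: size_nseq.
  by elim: n => [|n IH]; rewrite ?expr0 //= exprS IH.
exists [:: (w ++ v ++ [:: true], star u ^+ i)] => X.
by rewrite big_seq1 /= !word_cat /= mulr1 -ev /marker !mulrA.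
Qed.

End AsymptoticallyCentral.

(** * Columns indexed by words, and an approximate trace *)

Section Columns.
Variables (R : realType) (A : cstarType R) (s1 s2 : A).
Hypothesis hs : cuntz_pair s1 s2.
Implicit Types (x y z d : A) (w : seq bool) (F G : seq bool -> A).

(* The column with entries [F w], [size w = k], as the single element
   [\sum_w word w * F w]. *)
Fixpoint column k F : A :=
  if k is j.+1 then
    s1 * column j (fun w => F (true :: w)) + s2 * column j (fun w => F (false :: w))
  else F [::].

Lemma eq_column k F G : (forall w, F w = G w) -> column k F = column k G.
Proof.
elim: k F G => [|k IH] F G h /=; first exact: h.
by congr (_ * _ + _ * _); apply: IH => w.
Qed.

Lemma columnD k F G : column k (fun w => F w + G w) = column k F + column k G.
Proof.
by elim: k F G => [|k IH] F G //=; rewrite !IH !mulrDr addrACA.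
Qed.

Lemma column0 k : column k (fun _ => 0) = 0.
Proof. by elim: k => [|k IH] //=; rewrite IH !mulr0 addr0. Qed.

Lemma column_sum (I : Type) (l : seq I) k (F : I -> seq bool -> A) :
  column k (fun w => \sum_(i <- l) F i w) = \sum_(i <- l) column k (F i).
Proof.
elim: l => [|i l IH].
  by rewrite big_nil -[RHS](column0 k); apply: eq_column => w; rewrite big_nil.
by rewrite big_cons -IH -columnD; apply: eq_column => w; rewrite big_cons.
Qed.

Lemma column_mulr k F y : column k (fun w => F w * y) = column k F * y.
Proof. by elim: k F => [|k IH] F //=; rewrite !IH mulrDl !mulrA. Qed.

Lemma column_mull k F y :
  column k (fun w => y * F w) = iter k (cshift s1 s2) y * column k F.
Proof.
elim: k F => [|k IH] F //=.
by rewrite !IH mulrDr !mulrA (shift_s1 hs) (shift_s2 hs).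
Qed.

Lemma column_inner k F G : star (column k.+1 F) * column k.+1 G =
  star (column k (fun w => F (true :: w))) * column k (fun w => G (true :: w)) +
  star (column k (fun w => F (false :: w))) * column k (fun w => G (false :: w)).
Proof.
rewrite /= starD !starM mulrDl !mulrDr -!mulrA.
rewrite !(mulrA (star s1)) !(mulrA (star s2)).
by rewrite (cp11 hs) (cp12 hs) (cp21 hs) (cp22 hs) !mul1r !mul0r !mulr0 addr0 add0r.
Qed.

Lemma column_bound k F (c : R) : (forall w, nrm (F w) <= c) ->
  nrm (column k F) ^+ 2 <= c ^+ 2 *+ 2 ^ k.
Proof.
elim: k F => [|k IH] F h.
  by rewrite /= lerXn2r ?nnegrE ?nrm_ge0 ?(le_trans _ (h [::])) ?nrm_ge0.
rewrite -nrm_cstar column_inner (le_trans (nrmD _ _)) // !nrm_cstar.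
by rewrite expnS mul2n -addnn mulrnDr lerD // IH.
Qed.

Lemma column_const k F z : (forall w, star (F w) * F w = z) ->
  star (column k F) * column k F = z *+ 2 ^ k.
Proof.
elim: k F => [|k IH] F h; first by rewrite /= h.
by rewrite column_inner !IH // expnS mul2n -addnn mulrnDr.
Qed.

Definition word_column k x : A := column k (fun w => x * word s1 s2 w).

Lemma word_columnS k x :
  word_column k.+1 x = s1 * word_column k (x * s1) + s2 * word_column k (x * s2).
Proof.
by rewrite /word_column /=; congr (_ * _ + _ * _); apply: eq_column => w; rewrite mulrA.
Qed.

(** The column of [x * word w] is a block of the longer column of [x], cut out one letter at a time
    by the adjoint of an isometry. *)
Lemma word_column_word k x w :
  nrm (word_column k (x * word s1 s2 w)) <= nrm (word_column (k + size w) x).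
Proof.
elim: w x => [|b w IH] x /=; first by rewrite mulr1 addn0.
rewrite mulrA (le_trans (IH _)) // addnS word_columnS.
set X := word_column _ (x * s1); set Y := word_column _ (x * s2).
have hb : isometry_elt (ltr s1 s2 b) by rewrite /isometry_elt (ltrS_ltr hs) eqxx.
have -> : word_column (k + size w) (x * ltr s1 s2 b) =
    star (ltr s1 s2 b) * (s1 * X + s2 * Y).
  rewrite mulrDr !mulrA; case: (b) => /=.
    by rewrite (cp11 hs) (cp12 hs) mul1r mul0r addr0.
  by rewrite (cp21 hs) (cp22 hs) mul1r mul0r add0r.
by rewrite nrmM_le1l // nrm_star (isometry_nrm hb).
Qed.

(** Divided by [2^k], this stands in for the normalised trace of [F_2]. It is defined on all of [A],
    and on limits of matrix levels it is tracial up to an error that is small for large [k]. *)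
Definition transfer k x : A := iter k (fun z => star s1 * z * s1 + star s2 * z * s2) x.

Lemma transferS k x :
  transfer k.+1 x = transfer k (star s1 * x * s1 + star s2 * x * s2).
Proof. by rewrite /transfer iterSr. Qed.

Lemma transferD k x y : transfer k (x + y) = transfer k x + transfer k y.
Proof.
elim: k x y => [|k IH] x y //.
by rewrite !transferS -IH !mulrDr !mulrDl addrACA.
Qed.

Lemma word_column_inner k x y :
  star (word_column k x) * word_column k y = transfer k (star x * y).
Proof.
elim: k x y => [|k IH] x y; first by rewrite /word_column /= !mulr1.
rewrite transferS /word_column column_inner.
have e b z : column k (fun w => z * word s1 s2 (b :: w)) =
    word_column k (z * ltr s1 s2 b).
  by apply: eq_column => w /=; rewrite mulrA.
by rewrite !e !IH !starM /= -!mulrA transferD.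
Qed.

Lemma transferZ k (a : R[i]) x : transfer k (a *: x) = a *: transfer k x.
Proof.
elim: k x => [|k IH] x //.
by rewrite !transferS -IH -!scalerAr -!scalerAl -scalerDr.
Qed.

Lemma transferB k x y : transfer k (x - y) = transfer k x - transfer k y.
Proof. by rewrite -scaleN1r transferD transferZ scaleN1r. Qed.

Lemma transfer_bound k x : nrm (transfer k x) <= nrm x *+ 2 ^ k.
Proof.
elim: k x => [|k IH] x //; rewrite transferS (le_trans (IH _)) //.
rewrite expnS mulrnA lerMn2r expn_eq0 /= mulr2n.
apply: (le_trans (nrmD _ _)); apply: lerD; rewrite -mulrA.
  have h := isometry_nrm (cp11 hs).
  by rewrite (le_trans (nrmM_le1l _ _)) ?nrm_star ?h // nrmM_le1r ?h.
have h := isometry_nrm (cp22 hs).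
by rewrite (le_trans (nrmM_le1l _ _)) ?nrm_star ?h // nrmM_le1r ?h.
Qed.

(* Contains the matrix algebra spanned by the [word v * star (word w)] with
   [size v = size w = k], on which [transfer k] is a multiple of the trace. *)
Definition mat_level k x := forall v w, size v = k -> size w = k ->
  exists c : R[i], star (word s1 s2 v) * x * word s1 s2 w = c *: 1.

Lemma mat_levelS k x : mat_level k x -> mat_level k.+1 x.
Proof.
move=> hx v w; case/lastP: v => // v b; case/lastP: w => // w b'.
rewrite !size_rcons => -[sv] [sw]; have [c hc] := hx v w sv sw.
exists (c * (b == b')%:R); rewrite -!cats1 !word_cat /= !mulr1 starM.
rewrite -(mulrA (star (ltr _ _ _))) mulrA -(mulrA (star (ltr _ _ _))) hc.
rewrite -scalerAr -scalerAl mulr1 (ltrS_ltr hs) -scalerA; congr (_ *: _).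
by case: eqP; rewrite ?scale1r ?scale0r.
Qed.

Lemma mat_level_le k l x : (k <= l)%N -> mat_level k x -> mat_level l x.
Proof.
move=> kl hx; rewrite -(subnKC kl); elim: (l - k)%N => [|n IH]; rewrite ?addn0 //.
by rewrite addnS; apply: mat_levelS.
Qed.

Lemma mat_level_star k x : mat_level k x -> mat_level k (star x).
Proof.
move=> hx v w sv sw; have [c hc] := hx w v sw sv; exists (conjc c).
by have := congr1 (@star R A) hc; rewrite !starM starK mulrA starZ star1.
Qed.

Fixpoint words k : seq (seq bool) :=
  if k is j.+1 then map (cons true) (words j) ++ map (cons false) (words j) else [:: [::]].

Lemma size_words k w : w \in words k -> size w = k.
Proof.
elim: k w => [|k IH] w /=; first by rewrite inE => /eqP ->.
by rewrite mem_cat => /orP[] /mapP[v /IH <- ->].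
Qed.

Lemma words_sum k : \sum_(w <- words k) word s1 s2 w * star (word s1 s2 w) = 1.
Proof.
elim: k => [|k IH]; first by rewrite big_seq1 /= star1 mulr1.
rewrite /= big_cat !big_map /=.
have e b : \sum_(w <- words k) ltr s1 s2 b * word s1 s2 w * star (ltr s1 s2 b * word s1 s2 w)
    = ltr s1 s2 b * star (ltr s1 s2 b).
  transitivity (ltr s1 s2 b * 1 * star (ltr s1 s2 b)); last by rewrite mulr1.
  rewrite -IH big_distrr big_distrl /=.
  by apply: eq_bigr => w _; rewrite starM !mulrA.
by rewrite (e true) (e false) /= (cp_sum hs).
Qed.

Lemma transfer_words k x :
  transfer k x = \sum_(w <- words k) star (word s1 s2 w) * x * word s1 s2 w.
Proof.
elim: k x => [|k IH] x; first by rewrite big_seq1 /= star1 mulr1 mul1r.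
rewrite transferS transferD !IH /= big_cat !big_map /=.
by congr (_ + _); apply: eq_bigr => w _; rewrite starM !mulrA.
Qed.

(** Inserting the sum of the word projections between the factors expresses both sides through
    matrix entries, which are scalars and commute. *)
Lemma transfer_trace k x y : mat_level k x -> mat_level k y ->
  transfer k (x * y) = transfer k (y * x).
Proof.
move=> hx hy; rewrite !transfer_words.
have e x' y' : \sum_(w <- words k) star (word s1 s2 w) * (x' * y') * word s1 s2 w =
    \sum_(w <- words k) \sum_(v <- words k)
      (star (word s1 s2 w) * x' * word s1 s2 v) * (star (word s1 s2 v) * y' * word s1 s2 w).
  apply: eq_bigr => w _.
  transitivity (star (word s1 s2 w) * (x' * 1 * y') * word s1 s2 w); first by rewrite mulr1.
  rewrite -(words_sum k) big_distrr /= big_distrl /= big_distrr big_distrl /=.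
  by apply: eq_bigr => v _; rewrite !mulrA.
rewrite !e exchange_big /= big_seq [RHS]big_seq; apply: eq_bigr => v /size_words sv.
rewrite big_seq [RHS]big_seq; apply: eq_bigr => w /size_words sw.
have [c ->] := hx w v sw sv; have [d ->] := hy v w sv sw.
by rewrite -!scalerAl !mul1r !scalerA mulrC.
Qed.

Lemma transfer_asym_trace x :
  (forall e : R, 0 < e -> exists k y, mat_level k y /\ nrm (x - y) <= e) ->
  forall e : R, 0 < e -> exists k0, forall k, (k0 <= k)%N ->
    nrm (transfer k (star x * x) - transfer k (x * star x)) <= e *+ 2 ^ k.
Proof.
move=> hx e e0.
have key (d : R) y : nrm (x - y) <= d ->
    nrm (star x * x - star y * y) <= d * (2 * nrm x + d) /\
    nrm (x * star x - y * star y) <= d * (2 * nrm x + d).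
  move=> xy; have d0 : 0 <= d := le_trans (nrm_ge0 _) xy.
  have sxy : nrm (star x - star y) <= d by rewrite -starB nrm_star.
  have ny : nrm y <= nrm x + d.
    by have := nrmB x (x - y); rewrite subKr; lra.
  have nx := nrm_ge0 x; have ny0 := nrm_ge0 y.
  have split_diff (a b a' b' : A) : nrm (a - a') <= d -> nrm (b - b') <= d ->
      nrm b = nrm x -> nrm a' = nrm y ->
      nrm (a * b - a' * b') <= d * (2 * nrm x + d).
    move=> haa hbb nb na.
    have -> : a * b - a' * b' = (a - a') * b + a' * (b - b').
      by rewrite mulrBl mulrBr subrKA.
    have h1 := nrmD ((a - a') * b) (a' * (b - b')).
    have h2 : nrm ((a - a') * b) <= d * nrm x.
      by rewrite (le_trans (nrmM _ _)) // nb ler_wpM2r.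
    have h3 : nrm (a' * (b - b')) <= nrm y * d.
      by rewrite (le_trans (nrmM _ _)) // na ler_wpM2l.
    have h4 : nrm y * d <= (nrm x + d) * d by rewrite ler_wpM2r.
    by nra.
  by split; apply: split_diff; rewrite ?nrm_star.
(* Two products are perturbed, each by at most [d (2 |x| + d)]; the bound [d <= 1] makes this linear
   in [d]. *)
pose d := Num.min 1 (e / (2 * (2 * nrm x + 1))).
have K0 : 0 < 2 * (2 * nrm x + 1) by have := nrm_ge0 x; lra.
have d0 : 0 < d by rewrite lt_min ltr01 divr_gt0.
have de : 2 * (d * (2 * nrm x + d)) <= e.
  have d1 : d <= 1 by rewrite ge_min lexx.
  have : d <= e / (2 * (2 * nrm x + 1)) by rewrite ge_min lexx orbT.
  rewrite ler_pdivlMr //; have := nrm_ge0 x; nra.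
have [k0 [y [ly xy]]] := hx d d0; have [h1 h2] := key d y xy.
exists k0 => k k0k; have {}ly := mat_level_le k0k ly.
have -> : transfer k (star x * x) - transfer k (x * star x) =
    transfer k ((star x * x - star y * y) - (x * star x - y * star y)).
  rewrite !transferB (transfer_trace ly (mat_level_star ly)).
  by rewrite opprB addrA subrK.
rewrite (le_trans (transfer_bound _ _)) // lerMn2r; apply/orP; right.
by have := nrmB (star x * x - star y * y) (x * star x - y * star y); lra.
Qed.

End Columns.

(** * The approximate trace of the range projections *)

Section Ranges.
Variables (R : realType) (A : cstarType R) (s1 s2 t1 t2 : A).
Hypotheses (hs : cuntz_pair s1 s2) (ht : cuntz_pair t1 t2).

Definition range_proj n : A := t1 ^+ n * star t1 ^+ n.

Lemma range_projE n : star (range_proj n) * range_proj n = range_proj n.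
Proof.
have h : isometry_elt (t1 ^+ n) by apply/isometryX/(cp11 ht).
rewrite /range_proj -starX starM starK mulrA -(mulrA (t1 ^+ n)) h.
by rewrite mulr1.
Qed.

Lemma range_proj_split n (v := t1 ^+ n * t2 * star t1 ^+ n.+1) :
  range_proj n.+1 = star v * v /\ range_proj n = star v * v + v * star v.
Proof.
have hX j : star (t1 ^+ j) * t1 ^+ j = 1 by apply/isometryX/(cp11 ht).
have e1 : range_proj n.+1 = star v * v.
  rewrite /v !starM starX starK -!mulrA (mulrA (star (t1 ^+ n))) hX mul1r.
  by rewrite (mulrA (star t2)) (cp22 ht) mul1r.
split => //; rewrite -e1 /v -!starX !starM !starK.
rewrite -!mulrA (mulrA (star (t1 ^+ n.+1))) hX mul1r.
rewrite /range_proj -[t1 ^+ n in LHS]mulr1 -(cp_sum ht) mulrDr mulrDl.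
by rewrite (exprSr t1) (exprS (star t1)) (starX t1) !mulrA.
Qed.

(* The range of [t1^n] splits into two equivalent halves, one of which is the
   range of [t1^(n+1)]; the trace therefore halves at each step. *)
Lemma range_proj_transfer :
  (forall n, let v := t1 ^+ n * t2 * star t1 ^+ n.+1 in
    forall e : R, 0 < e -> exists k y, mat_level s1 s2 k y /\ nrm (v - y) <= e) ->
  forall n (e : R), 0 < e -> exists k0, forall k, (k0 <= k)%N ->
    nrm (transfer s1 s2 k (range_proj n)) <= (2^-1 ^+ n + e) *+ 2 ^ k.
Proof.
move=> hv; elim=> [|n IH] e e0.
  exists 0%N => k _; rewrite /range_proj !expr0 mulr1 (le_trans (transfer_bound hs _ _)) //.
  by rewrite nrm1 lerMn2r; apply/orP; right; lra.
have [k1 h1] := IH e e0; have [k2 h2] := transfer_asym_trace hs (hv n) e0.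
exists (maxn k1 k2) => k; rewrite geq_max => /andP[/h1 {}h1 /h2 {}h2].
have [e1 e2] := range_proj_split n; move: h1 h2.
set v := t1 ^+ n * t2 * _ in e1 e2 *; rewrite e1 e2 transferD.
set X := transfer _ _ _ _; set Y := transfer _ _ _ _ => h1 h2.
(* The induction bounds [X + Y] and the trace property bounds [X - Y]. Halving absorbs both errors,
   so the same [e] serves for every [n]. *)
have nX : 2 * nrm X = nrm ((X + Y) + (X - Y)).
  have -> : X + Y + (X - Y) = (2 : R)%:C%C *: X.
    by rewrite addrACA subrr addr0 rmorph_nat scaler_nat mulr2n.
  by rewrite nrmZr.
have := nrmD (X + Y) (X - Y); rewrite -nX exprS.
have [N eN] : exists N : R, forall c, c *+ 2 ^ k = c * N.
  by exists (2 ^ k)%:R => c; rewrite mulr_natr.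
by move: h1 h2; rewrite !eN; lra.
Qed.

End Ranges.

(** * Two vanishing criteria for asymptotically central elements *)

Section Vanishing.
Variables (R : realType) (A : cstarType R) (u s2 s1 : A).
Hypotheses (hus : Q2_relations u s2) (s1E : s1 = u * s2).
Let hs := Q2_cuntz hus s1E.
Local Notation W := (central_isom u s2 s1).

(* Choosing [X = s2] makes the ranges of [W X] and of [s1^n] orthogonal for
   large [n]. *)
Lemma asym_central_range_vanish d : asym_central u s2 s1 d ->
  (forall n, (0 < n)%N -> d * range_proj s1 n = d) -> d = 0.
Proof.
move=> hd dP; apply: (@nrm_eps_eq0 _ _ 1) => // e e0; rewrite mul1r.
have is2 : isometry_elt s2 := cp22 hs.
have [m /(_ m s2 (leqnn m) is2)] := hd e e0.
have [l hl] := central_isom_words hus s1E m.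
(* The word [w] followed by [s2] has at most [n] letters, one of them [s2], so its range is
   orthogonal to that of [s1 ^+ n]. *)
have kill n w : (size w < n)%N -> star s1 ^+ n * (word s1 s2 w * s2) = 0.
  elim: n w => // n IH [|b w] /=; rewrite exprSr -mulrA.
    by rewrite mul1r (cp12 hs) mulr0.
  move=> /IH h; rewrite !mulrA -(mulrA _ (star s1)) -(mulrA _ _ (word _ _ w)).
  rewrite -[star s1]/(star (ltr s1 s2 true)) (ltrS_ltr hs) -mulrA.
  by case: b; rewrite /= ?mul0r ?mulr0 // mul1r h.
have [n n0 hn] : exists2 n, (0 < n)%N & forall p, p \in l -> (size p.1 < n)%N.
  elim: (l) => [|p l' [n n0 hn]]; first by exists 1%N.
  exists (maxn n (size p.1).+1) => [|q]; first by rewrite leq_max n0.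
  by rewrite inE => /orP[/eqP ->|/hn h]; rewrite leq_max ?leqnn ?orbT ?h.
have -> : d * W m s2 = 0.
  rewrite -(dP n n0) -mulrA /range_proj hl big_distrr /= big1_seq ?mulr0 // => p /andP[_ pl].
  by rewrite mulrA -(mulrA (s1 ^+ n)) kill ?mulr0 ?mul0r // hn.
(* With [d * W] zero the commutator is [- W * d], whose norm is that of [d]. *)
by rewrite sub0r nrmN isometry_nrmM //; apply: central_isom_isometry.
Qed.

(** Over the [2^k] words [X] of length [k], the column of [W X * d] has norm [2^(k/2) |d|]. Moving
    [d] to the left costs at most [e] per entry, and [d = d * p] leaves a column of norm at most
    [2^(k/2) e |d|]. Hence [|d| <= (|d| + 1) e]. *)
Lemma asym_central_trace_vanish d : asym_central u s2 s1 d ->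
  (forall e : R, 0 < e -> exists2 p, d * p = d & exists k0, forall k, (k0 <= k)%N ->
    nrm (word_column s1 s2 k p) ^+ 2 <= e ^+ 2 *+ 2 ^ k) -> d = 0.
Proof.
move=> hd hp; have nd := nrm_ge0 d.
apply: (@nrm_eps_eq0 _ _ (nrm d + 1)) => [|e e0]; first by lra.
have [m /(_ m _ (leqnn m)) hm] := hd e e0.
have [l hl] := central_isom_words hus s1E m.
pose r := Num.sqrt (2 : R); have r2 : r ^+ 2 = 2 by rewrite sqr_sqrtr.
have r0 : 0 < r by rewrite sqrtr_gt0.
have rX k : 0 < r ^+ k by rewrite exprn_gt0.
have sq_le (c : R) x k : 0 <= c -> nrm x ^+ 2 <= c ^+ 2 *+ 2 ^ k -> nrm x <= c * r ^+ k.
  move=> c0 h; rewrite -(@ler_pXn2r _ 2) ?nnegrE ?nrm_ge0 ?mulr_ge0 ?(ltW (rX _)) //.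
  by rewrite exprMn -exprM mulnC exprM r2 (le_trans h) // -[leLHS]mulr_natr natrX.
(* [C] is fixed before [p]: a word of length [j] in front of [X] lengthens the column by [j]
   letters, at the cost of a factor [r ^+ j]. *)
pose C := \sum_(p <- l) r ^+ size p.1 * nrm p.2.
have C0 : 0 <= C by apply: sumr_ge0 => p _; rewrite mulr_ge0 ?nrm_ge0 ?(ltW (rX _)).
have eC : 0 < e / (C + 1) by rewrite divr_gt0 //; lra.
have [p dp [k hk]] := hp _ eC.
have cW : nrm (column s1 s2 k (fun w => p * W m (word s1 s2 w))) <= e * r ^+ k.
  have -> : column s1 s2 k (fun w => p * W m (word s1 s2 w)) =
      \sum_(q <- l) word_column s1 s2 k (p * word s1 s2 q.1) * q.2.
    under eq_bigr do rewrite /word_column -column_mulr.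
    rewrite -column_sum; apply: eq_column => w; rewrite hl big_distrr /=.
    by apply: eq_bigr => q _; rewrite !mulrA.
  apply: (@le_trans _ _ ((e / (C + 1)) * r ^+ k * C)); last first.
    have -> : e / (C + 1) * r ^+ k * C = e * r ^+ k * (C / (C + 1)).
      by ring.
    by rewrite ler_piMr ?mulr_ge0 ?(ltW e0) ?(ltW (rX _)) // ler_pdivrMr; lra.
  rewrite (le_trans (nrm_sum _ _ _)) // /C big_distrr /= ler_sum // => q _.
  rewrite (le_trans (nrmM _ _)) // mulrA ler_wpM2r ?nrm_ge0 //.
  rewrite (le_trans (word_column_word hs _ _ _)) // -mulrA -exprD.
  by apply: sq_le; [exact: ltW | apply: hk; exact: leq_addr].
pose F w := W m (word s1 s2 w) * d.
have nF : nrm (column s1 s2 k F) = r ^+ k * nrm d.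
  apply/eqP; rewrite -(@eqrXn2 _ 2) ?mulr_ge0 ?nrm_ge0 ?(ltW (rX _)) //.
  rewrite exprMn -exprM mulnC exprM r2 -!nrm_cstar (column_const hs k (z := star d * d)).
    have -> : (star d * d) *+ 2 ^ k = (2 ^+ k : R)%:C%C *: (star d * d).
      by rewrite rmorphXn rmorph_nat -natrX scaler_nat.
    by rewrite nrmZr ?exprn_ge0.
  move=> w; rewrite /F starM -mulrA (mulrA (star (W _ _))).
  by rewrite central_isom_isometry ?mul1r //; exact: word_isometry hs w.
have : nrm (column s1 s2 k F) <= nrm d * (e * r ^+ k) + e * r ^+ k.
  have -> : column s1 s2 k F = column s1 s2 k (fun w => d * (p * W m (word s1 s2 w))) +
      column s1 s2 k (fun w => F w - d * W m (word s1 s2 w)).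
    rewrite -columnD; apply: eq_column => w.
    by rewrite mulrA dp addrC subrK.
  rewrite (le_trans (nrmD _ _)) // lerD //.
    rewrite (column_mull hs) (le_trans (nrmM _ _)) // ler_pM ?nrm_ge0 //.
    exact: (shom_contractive (iter_cshift_star_hom hs k)).
  apply: sq_le; rewrite ?(ltW e0) //; apply: (column_bound hs) => w.
  by rewrite nrm_distC hm //; exact: word_isometry hs w.
rewrite nF => h; rewrite -(ler_pM2l (rX k)); lra.
Qed.

End Vanishing.

(** * Density of a *-subalgebra containing the generators *)

Lemma cstar_gen_approx (R : realType) (A : cstarType R) (S N : set A) :
  N 1 -> (forall x y, N x -> N y -> N (x + y)) ->
  (forall (a : R[i]) x, N x -> N (a *: x)) ->
  (forall x y, N x -> N y -> N (x * y)) ->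
  (forall x, N x -> N (star x)) -> S `<=` N ->
  forall x, cstar_gen S x -> forall e : R, 0 < e -> exists2 y, N y & nrm (x - y) <= e.
Proof.
move=> h1 hD hZ hM hS SN.
pose C (x : A) := forall e : R, 0 < e -> exists2 y, N y & nrm (x - y) <= e.
have NC x : N x -> C x by move=> Nx e e0; exists x => //; rewrite subrr nrm0 ltW.
have CM x y : C x -> C y -> C (x * y).
  move=> hx hy e e0; have nx := nrm_ge0 x; have ny := nrm_ge0 y.
  pose d := Num.min 1 (e / (nrm x + nrm y + 1)).
  have K0 : 0 < nrm x + nrm y + 1 by lra.
  have d0 : 0 < d by rewrite lt_min ltr01 divr_gt0.
  have d1 : d <= 1 by rewrite ge_min lexx.
  have de : d * (nrm x + nrm y + 1) <= e.
    by rewrite -ler_pdivlMr // ge_min lexx orbT.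
  have [x' Nx' xx'] := hx d d0; have [y' Ny' yy'] := hy d d0.
  exists (x' * y'); first exact: hM.
  have -> : x * y - x' * y' = (x - x') * y + x' * (y - y').
    by rewrite mulrBl mulrBr subrKA.
  have ny' : nrm x' <= nrm x + d by have := nrmB x (x - x'); rewrite subKr; lra.
  have b1 : nrm ((x - x') * y) <= d * nrm y.
    by rewrite (le_trans (nrmM _ _)) // ler_wpM2r.
  have b2 : nrm (x' * (y - y')) <= (nrm x + d) * d.
    by rewrite (le_trans (nrmM _ _)) // ler_pM // nrm_ge0.
  have := nrmD ((x - x') * y) (x' * (y - y')); nra.
suff h : cstar_gen S `<=` C by move=> x /h.
apply: cstar_gen_ind => //.
- exact: NC.
- move=> x y hx hy e e0; have e2 : 0 < e / 2 by rewrite divr_gt0.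
  have [x' Nx' xx'] := hx _ e2; have [y' Ny' yy'] := hy _ e2.
  exists (x' + y'); first exact: hD.
  by rewrite opprD addrACA (le_trans (nrmD _ _)) //; lra.
- move=> a x hx; rewrite -[x]mul1r scalerAl; apply: CM => //.
  by apply/NC/hZ.
- by move=> x hx e /hx[y Ny xy]; exists (star y); [exact: hS | rewrite -starB nrm_star].
- move=> x hx e e0; have e2 : 0 < e / 2 by rewrite divr_gt0.
  have [y Cy xy] := hx _ e2; have [z Nz yz] := Cy _ e2.
  by exists z => //; have := nrm_dist_trans y x z; lra.
- by move=> x /SN; apply: NC.
Qed.

(** * Gauge degrees and matrix approximation in [F_2] *)

Section Gauge.
Variables (R : realType) (Q : cstarType R) (u s2 s1 : Q).
Hypotheses (hQ : is_Q2 u s2) (s1E : s1 = u * s2).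
Let hus : Q2_relations u s2 := Q2_rel hQ.
Let hs := Q2_cuntz hus s1E.
Implicit Types (x y z : Q) (t : R[i]) (v w : seq bool).

Lemma unimodular_conj t : `|t| = 1 -> t * conjc t = 1.
Proof. by move=> ht; have := normCK t; rewrite ht expr1n => <-. Qed.

(** Universality gives endomorphisms for [t] and for its conjugate; their composites fix the
    generators, so they are mutually inverse. *)
Lemma gauge_exists t : `|t| = 1 -> exists alpha, gauge_auto u s2 t alpha.
Proof.
have mk t' : `|t'| = 1 -> exists f : Q -> Q, [/\ star_hom f, f u = u & f s2 = t' *: s2].
  move=> ht; apply: (Q2_univ hQ); case: hus => h1 h2 h3 h4.
  have tt : conjc t' * t' = 1 by rewrite mulrC unimodular_conj.
  split => //.
  - by rewrite /isometry_elt starZ -scalerAl -scalerAr scalerA tt scale1r.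
  - by rewrite -scalerAl h3 scalerAr.
  - rewrite starZ -!scalerAr -!scalerAl !scalerA.
    by rewrite tt !scale1r -!mulrA -h4 !mulrA.
move=> ht; have ht' : `|conjc t| = 1.
  have : `|t * conjc t| = 1 by rewrite unimodular_conj ?normr1.
  by rewrite normrM ht mul1r.
have [f [hf fu fs]] := mk t ht; have [g [hg gu gs]] := mk (conjc t) ht'.
have id_hom : star_hom (@id Q) by split.
have id_gen (h : Q -> Q) : star_hom h -> h u = u -> h s2 = s2 -> h = id.
  move=> hh hu h2; apply: (star_hom_eq_gen hh id_hom (Q2_gen hQ)).
  by move=> x [->|->].
have tt : conjc t * t = 1 by rewrite mulrC unimodular_conj.
exists f; split => //; split; first by split.
exists g => x.
  have -> : g (f x) = (g \o f) x by [].
  rewrite (id_gen (g \o f)) //=; first exact: star_hom_comp.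
    by rewrite fu gu.
  by rewrite fs (shomZ hg) gs scalerA mulrC tt scale1r.
have -> : f (g x) = (f \o g) x by [].
rewrite (id_gen (f \o g)) //=; first exact: star_hom_comp.
  by rewrite gu fu.
by rewrite gs (shomZ hf) fs scalerA tt scale1r.
Qed.

(** The degree is the integer [a - b], kept as a pair of naturals with [conjc t] as the inverse of
    [t]. *)
Definition gauge_degree a b z := forall t alpha, `|t| = 1 ->
  gauge_auto u s2 t alpha -> alpha z = (t ^+ a * conjc t ^+ b) *: z.

(* Together with [gauge_degree], this describes the span of the elements
   [word v * star (word w)] with [size v - size w = a - b]. *)
Definition local a b k z := forall v w,
  (size v + b = size w + a)%N -> (k <= size v)%N -> (k <= size w)%N ->
  exists c : R[i], star (word s1 s2 v) * z * word s1 s2 w = c *: 1.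

Definition homogeneous a b z := gauge_degree a b z /\ exists k, local a b k z.

Lemma gauge_hom t alpha : gauge_auto u s2 t alpha -> star_hom alpha.
Proof. by case=> [[[]]]. Qed.

Lemma homogeneousM a b a' b' z z' :
  homogeneous a b z -> homogeneous a' b' z' -> homogeneous (a + a') (b + b') (z * z').
Proof.
move=> [gz [k hk]] [gz' [k' hk']]; split.
  move=> t alpha ht hal; rewrite (shomM (gauge_hom hal)) (gz _ _ ht hal) (gz' _ _ ht hal).
  by rewrite -scalerAl -scalerAr scalerA !exprD mulrACA.
exists (k + k' + a + b)%N => v w svw kv kw.
(* The words of length [n] are inserted between [z] and [z']. The degree of [z] dictates [n], and
   the bound on [size v] keeps it above [k] and [k']. *)
have kap : exists n, (n + a = size v + b)%N /\ (n + b' = size w + a')%N.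
  exists (size v + b - a)%N; move: svw kv kw; move: (size v) (size w) => p q.
  by lia.
have [n [n1 n2]] := kap.
have [kv1 kw1 kn kn'] : [/\ (k <= size v)%N, (k' <= size w)%N, (k <= n)%N & (k' <= n)%N].
  by move: svw kv kw n1 n2; move: (size v) (size w) => p q; split; lia.
have lem (l : seq (seq bool)) : (forall x : seq bool, x \in l -> size x = n) -> exists c : R[i],
    star (word s1 s2 v) * (z * (\sum_(x <- l) word s1 s2 x * star (word s1 s2 x)) * z') *
    word s1 s2 w = c *: 1.
  elim: l => [|x l IH] sl.
    by exists 0; rewrite big_nil mulr0 mul0r mulr0 mul0r scale0r.
  have [|c hc] := IH; first by move=> x' x'l; apply: sl; rewrite inE x'l orbT.
  have sx : size x = n by apply: sl; rewrite mem_head.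
  have [c1 hc1] : exists c1 : R[i], star (word s1 s2 v) * z * word s1 s2 x = c1 *: 1.
    by apply: hk; rewrite ?sx.
  have [c2 hc2] : exists c2 : R[i], star (word s1 s2 x) * z' * word s1 s2 w = c2 *: 1.
    by apply: hk'; rewrite ?sx.
  exists (c1 * c2 + c); rewrite big_cons mulrDr !mulrDl mulrDr mulrDl hc scalerDl.
  congr (_ + _); rewrite !mulrA hc1.
  by rewrite -!scalerAl mul1r hc2 scalerA.
have := lem _ (@size_words n); rewrite (words_sum hs) mulr1; exact.
Qed.

Lemma homogeneous_star a b z : homogeneous a b z -> homogeneous b a (star z).
Proof.
move=> [gz [k hk]]; split.
  move=> t alpha ht hal; rewrite (shomS (gauge_hom hal)) (gz _ _ ht hal) starZ.
  by rewrite rmorphM !rmorphXn /= conjcK mulrC.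
exists k => v w svw kv kw; have [c hc] := hk w v (esym svw) kw kv.
by exists (conjc c); have := congr1 (@star R Q) hc; rewrite !starM starK mulrA starZ star1.
Qed.

Lemma homogeneousZ a b (c : R[i]) z : homogeneous a b z -> homogeneous a b (c *: z).
Proof.
move=> [gz [k hk]]; split.
  move=> t alpha ht hal; rewrite (shomZ (gauge_hom hal)) (gz _ _ ht hal).
  by rewrite !scalerA mulrC.
exists k => v w svw kv kw; have [d hd] := hk v w svw kv kw.
by exists (c * d); rewrite -scalerAr -scalerAl hd scalerA.
Qed.

Lemma homogeneous1 : homogeneous 0 0 1.
Proof.
split.
  by move=> t alpha _ /gauge_hom h; rewrite (shom1 h) !expr0 mulr1 scale1r.
exists 0%N => v w; rewrite !addn0 => svw _ _; exists (v == w)%:R.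
by rewrite mulr1 (wordS_word hs svw); case: eqP; rewrite ?scale1r ?scale0r.
Qed.

Lemma homogeneous_ltr b : homogeneous 1 0 (ltr s1 s2 b).
Proof.
split.
  move=> t alpha ht hal; have h := gauge_hom hal; case: hal => _ au as2.
  rewrite expr0 expr1 mulr1; case: b => //=.
  by rewrite s1E (shomM h) au as2 scalerAr.
exists 0%N => v w; rewrite addn0 addn1 => svw _ _; exists (v == b :: w)%:R.
by rewrite -mulrA (wordS_word hs (w := b :: w) svw); case: eqP; rewrite ?scale1r ?scale0r.
Qed.

Inductive graded : Q -> Prop :=
| Graded0 : graded 0
| GradedD a b z y : homogeneous a b z -> graded y -> graded (z + y).

Lemma homogeneous_graded a b z : homogeneous a b z -> graded z.
Proof. by move=> hz; rewrite -[z]addr0; apply: GradedD hz Graded0. Qed.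

Lemma gradedD x y : graded x -> graded y -> graded (x + y).
Proof.
move=> + hy; elim=> [|a b z x' hz _ IH]; first by rewrite add0r.
by rewrite -addrA; apply: GradedD hz IH.
Qed.

Lemma gradedZ (c : R[i]) x : graded x -> graded (c *: x).
Proof.
elim=> [|a b z x' hz _ IH]; first by rewrite scaler0; exact: Graded0.
by rewrite scalerDr; apply: GradedD (homogeneousZ c hz) IH.
Qed.

Lemma gradedM x y : graded x -> graded y -> graded (x * y).
Proof.
move=> + hy; elim=> [|a b z x' hz _ IH]; first by rewrite mul0r; exact: Graded0.
rewrite mulrDl; apply: gradedD => //.
elim: hy => [|a' b' z' y' hz' _ IH']; first by rewrite mulr0; exact: Graded0.
by rewrite mulrDr; apply: GradedD IH'; apply: homogeneousM hz hz'.
Qed.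

Lemma graded_star x : graded x -> graded (star x).
Proof.
elim=> [|a b z x' hz _ IH]; first by rewrite star0; exact: Graded0.
by rewrite starD; apply: GradedD IH; apply: homogeneous_star hz.
Qed.

Lemma O2_graded_approx x : O2 u s2 x ->
  forall e : R, 0 < e -> exists2 y, graded y & nrm (x - y) <= e.
Proof.
apply: cstar_gen_approx.
- exact: homogeneous_graded homogeneous1.
- exact: gradedD.
- exact: gradedZ.
- exact: gradedM.
- exact: graded_star.
move=> y [->|->]; apply: homogeneous_graded.
  by have := homogeneous_ltr true; rewrite /= s1E; apply.
exact: homogeneous_ltr false.
Qed.

Lemma unimodular_root n : (0 < n)%N -> exists2 t : R[i], `|t| = 1 & t ^+ n = -1.
Proof.
move=> n0; exists (n.-root (-1)); last exact: rootCK.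
by apply/eqP; rewrite -(pexpr_eq1 n0) // -normrX rootCK // normrN1.
Qed.

Lemma degree_kill a b : a <> b ->
  exists2 t : R[i], `|t| = 1 & t ^+ a * conjc t ^+ b = -1.
Proof.
(* With truncated subtraction this sum is the distance between [a] and [b]. *)
move=> ab; have pos : (0 < (a - b) + (b - a))%N by lia.
have tt (t : R[i]) : `|t| = 1 -> forall k, t ^+ k * conjc t ^+ k = 1.
  by move=> /unimodular_conj h k; rewrite -exprMn h expr1n.
have [t ht tn] := unimodular_root pos; exists t => //.
have [lt|lt|//] := ltngtP a b.
  rewrite -(subnKC (ltnW lt)) exprD mulrA tt // mul1r -rmorphXn.
  by move: tn; rewrite (eqP (ltnW lt)) add0n => ->; rewrite rmorphN rmorph1.
rewrite -(subnKC (ltnW lt)) exprD mulrAC tt // mul1r.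
by move: tn; rewrite (eqP (ltnW lt)) addn0.
Qed.

Definition gauge_invariant x := forall t alpha, `|t| = 1 ->
  gauge_auto u s2 t alpha -> alpha x = x.

(** Finite averages of gauge automorphisms replace the integral over the circle. By [ga_diag]
    homogeneous elements remain eigenvectors, so a further term can be killed after the averages
    already chosen. *)
Record gauge_average (T : Q -> Q) : Prop := GaugeAverage {
  ga_contr : forall x, nrm (T x) <= nrm x;
  ga_D : forall x y, T (x + y) = T x + T y;
  ga_Z : forall (c : R[i]) x, T (c *: x) = c *: T x;
  ga_id : forall x, gauge_invariant x -> T x = x;
  ga_diag : forall a b z, homogeneous a b z -> exists c : R[i], T z = c *: z
}.

(* [(1 + alpha_t) / 2] kills the degree [a - b] when [t ^ (a - b) = -1]; finitely
   many such averages leave only the degree zero. *)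
Lemma graded_average y : graded y -> exists2 T, gauge_average T &
  gauge_invariant (T y) /\ exists k, mat_level s1 s2 k (T y).
Proof.
elim=> [|a b z x hz _ [T hT [gT [k hk]]]].
  exists id; first by split => // a b z _; exists 1; rewrite scale1r.
  split; first by move=> t alpha _ /gauge_hom h; rewrite (shom0 h).
  by exists 0%N => v w _ _; exists 0; rewrite mulr0 mul0r scale0r.
have [c hc] := ga_diag hT hz.
have [ab|ab] := eqVneq a b.
  exists T => //; rewrite (ga_D hT) hc; case: hz => gz [k' hk']; split.
    move=> t alpha ht hal; have h := gauge_hom hal.
    rewrite (shomD h) (gT _ _ ht hal) (shomZ h) (gz _ _ ht hal) ab.
    by rewrite -exprMn unimodular_conj // expr1n scale1r.
  exists (k + k')%N => v w sv sw.
  have {}hk := mat_level_le hs (leq_addr k' k) hk.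
  have [d1 h1] := hk v w sv sw.
  have [d2 h2] : exists d2 : R[i], star (word s1 s2 v) * z * word s1 s2 w = d2 *: 1.
    by apply: hk'; rewrite ?sv ?sw ?ab // leq_addl.
  exists (c * d2 + d1).
  by rewrite mulrDr mulrDl h1 -scalerAr -scalerAl h2 scalerA scalerDl.
have [t ht tab] := degree_kill (elimN eqP ab).
have [alpha hal] := gauge_exists ht; have h := gauge_hom hal.
pose S x := (2^-1 : R)%:C%C *: (x + alpha x).
have half x' : (2^-1 : R)%:C%C *: (x' + x') = x'.
  rewrite -[x' in x' + x']scale1r -scalerDl scalerA.
  by rewrite -(rmorph1 (real_complex R)) -rmorphD -rmorphM mulVf ?scale1r // pnatr_eq0.
have hS : gauge_average (S \o T).
  split => /=.
  - move=> x'; rewrite nrmZr ?invr_ge0 //; have := nrmD (T x') (alpha (T x')).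
    by have := shom_contractive h (T x'); have := ga_contr hT x'; lra.
  - by move=> x' y'; rewrite /S (ga_D hT) (shomD h) addrACA scalerDr.
  - move=> d x'; rewrite /S (ga_Z hT) (shomZ h) -scalerDr !scalerA.
    by rewrite mulrC.
  - by move=> x' hx'; rewrite (ga_id hT hx') /S (hx' _ _ ht hal) half.
  move=> a' b' z' hz'; have [d ->] := ga_diag hT hz'; have [gz' _] := hz'.
  rewrite /S (shomZ h) (gz' _ _ ht hal) -scalerDr scalerA.
  set e := t ^+ a' * _; exists ((2^-1 : R)%:C%C * d * (1 + e)).
  by rewrite -[in RHS]scalerA scalerDl scale1r.
exists (S \o T) => //=; rewrite (ga_D hT).
have -> : S (T z + T x) = T x; last by split => //; exists k.
have [gz _] := hz.
have az : alpha (T z) = - T z.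
  by rewrite hc (shomZ h) (gz _ _ ht hal) tab scaleN1r scalerN.
by rewrite /S (shomD h) (gT _ _ ht hal) az addrACA subrr add0r half.
Qed.

(** A gauge average fixes [x] and contracts, so averaging a graded approximant brings it into a
    matrix level without moving it away from [x]. *)
Lemma F2_mat_approx x : F2 u s2 x ->
  forall e : R, 0 < e -> exists k y, mat_level s1 s2 k y /\ nrm (x - y) <= e.
Proof.
move=> [xO xg] e e0; have [y gy xy] := O2_graded_approx xO e0.
have [T hT [_ [k hk]]] := graded_average gy; exists k, (T y); split => //.
have -> : x - T y = T (x - y).
  by rewrite -[in RHS](scaleN1r y) (ga_D hT) (ga_Z hT) scaleN1r (ga_id hT xg).
exact: le_trans (ga_contr hT _) xy.
Qed.

(** There are [n + 1] generators against [n + 1] adjoints, so the gauge degree is zero. *)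
Lemma F2_partial_isometry n : F2 u s2 (s1 ^+ n * s2 * star s1 ^+ n.+1).
Proof.
have O1 : O2 u s2 s1 by apply: cstar_gen_sub; left; rewrite s1E.
have O2' : O2 u s2 s2 by apply: cstar_gen_sub; right.
split.
  apply: cstar_genM; last exact: cstar_genX (cstar_gen_star O1).
  by apply: cstar_genM => //; exact: cstar_genX O1.
have hX j : homogeneous j 0 (s1 ^+ j).
  elim: j => [|j IH]; first exact: homogeneous1.
  by rewrite exprS -[0%N]addn0 -add1n; exact: homogeneousM (homogeneous_ltr true) IH.
have [gz _] := homogeneousM (homogeneousM (hX n) (homogeneous_ltr false))
  (homogeneous_star (hX n.+1)).
move=> t alpha ht hal; rewrite -starX [LHS](gz t alpha ht hal) !addn0 add0n addn1.
by rewrite -exprMn unimodular_conj // expr1n scale1r.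
Qed.

End Gauge.

(** * Comparison of two extensions *)

Lemma star_hom_Q2_relations (R : realType) (A D : cstarType R) (f : A -> D) (u s2 : A) :
  star_hom f -> Q2_relations u s2 -> Q2_relations (f u) (f s2).
Proof.
move=> hf [[h1 h2] h3 h4 h5]; split.
- by split; rewrite -(shomS hf) -(shomM hf) ?h1 ?h2 (shom1 hf).
- by rewrite /isometry_elt -(shomS hf) -(shomM hf) h3 (shom1 hf).
- by rewrite -(shomX hf) -!(shomM hf) h4.
- by rewrite -!(shomS hf) -!(shomM hf) -(shomD hf) h5 (shom1 hf).
Qed.

Lemma range_proj_star (R : realType) (A : cstarType R) (t1 : A) n :
  star (range_proj t1 n) = range_proj t1 n.
Proof. by rewrite /range_proj starM !starX starK. Qed.

Theorem theorem4p1 (R : realType) (Q : cstarType R) (u s2 : Q)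
    (hQ : is_Q2 u s2)
    (w : Q) (hwO : O2 u s2 w) (hwU : unitary w)
    (lam : Q -> Q) (hlam : is_lambda u s2 w lam)
    (hext : extendable u s2 lam)
    (hcond :
       (lam @` F2 u s2 `<=` F2 u s2)
       \/
       (exists B : set Q, exists E : Q -> Q,
          [/\ cstar_subalg B,
              B `<=` lam @` O2 u s2,
              forall n : nat, (1 <= n)%N ->
                B (lam (Q2_s1 u s2 ^+ n * star (Q2_s1 u s2) ^+ n)),
              cond_expectation B E
            & faithful E])) :
  exists! Phi : Q -> Q, is_extension u s2 lam Phi.
Proof.
case: hext => Phi hPhi; exists Phi; split => // Psi [[hPsi _] Psi_lam].
case: (hPhi) => -[hf _] Phi_lam; have hus := Q2_rel hQ.
have [s1 s1E] : exists s1, s1 = Q2_s1 u s2 by exists (Q2_s1 u s2).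
have {}s1E : s1 = u * s2 := s1E.
have O1 : O2 u s2 s1 by apply: cstar_gen_sub; left; rewrite s1E.
have O2' : O2 u s2 s2 by apply: cstar_gen_sub; right.
pose v := Phi u; pose t2 := Phi s2; pose t1 := Phi s1; pose v' := Psi u.
have hvt : Q2_relations v t2 := star_hom_Q2_relations hf hus.
have t1E : t1 = v * t2 by rewrite /t1 s1E (shomM hf).
have t2E : Psi s2 = t2 by rewrite Psi_lam // -Phi_lam.
have t1E' : Psi s1 = t1 by rewrite Psi_lam // -Phi_lam.
have hs := Q2_cuntz hus s1E; have ht := Q2_cuntz hvt t1E.
have vt1 : v * t1 = t2 * v by rewrite -!(shomM hf) (u_s1 hus s1E).
have vt1' : v' * t1 = t2 * v' by rewrite -t1E' -t2E -!(shomM hPsi) (u_s1 hus s1E).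
have vt2' : v' * t2 = t1 by rewrite -t2E -(shomM hPsi) -s1E.
(* Both extensions agree on [s2], so agreement on [u] is enough. *)
suff vv : v - v' = 0.
  apply: (star_hom_eq_gen hf hPsi (Q2_gen hQ)) => x [->|->]; last by rewrite t2E.
  by apply/eqP; rewrite -subr_eq0; apply/eqP.
set d := v - v'.
(* The part of [d] on the range of [t2] vanishes, because [v] and [v'] both send [t2] to [t1]. *)
have dE : d = t2 * d * star t1.
  rewrite -[LHS]mulr1 -(cp_sum ht) mulrDr !mulrA /d !mulrBl vt1 vt1' vt2' -t1E.
  by rewrite subrr addr0 mulrBr mulrBl.
have dX n : d = t2 ^+ n * d * star t1 ^+ n.
  elim: n => [|n IH]; first by rewrite !expr0 mul1r mulr1.
  by rewrite {1}IH {1}dE exprSr exprS !mulrA.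
have dP n : d * range_proj t1 n = d.
  have h : star t1 ^+ n * t1 ^+ n = 1 by rewrite -starX; apply/isometryX/(cp11 ht).
  rewrite {1}(dX n) /range_proj mulrA -(mulrA (t2 ^+ n * d)) h mulr1.
  by rewrite -dX.
case: hcond => [hF2|[B [E [hB Blam PB hE fE]]]].
  apply: (asym_central_trace_vanish hus s1E).
    apply: (asym_central_hom hus s1E (f := id) (v := u) (t := s2)) => //.
    by rewrite (Q2_gen hQ).
  (* One half of [e ^+ 2] covers [2^-n], the other the error of the approximate trace. *)
  move=> e e0; have e2 : 0 < e ^+ 2 / 2 by rewrite divr_gt0 ?exprn_gt0.
  have [n /(_ n (leqnn n)) hn] := half_pow_small (exprn_gt0 2 e0).
  exists (range_proj t1 n) => //.
  have [|k0 hk0] := range_proj_transfer hs ht _ n e2.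
    move=> j; apply: (F2_mat_approx hQ s1E); apply: hF2.
    have xF := F2_partial_isometry hQ s1E j.
    exists (s1 ^+ j * s2 * star s1 ^+ j.+1) => //; case: xF => xO _.
    by rewrite -Phi_lam // !(shomM hf) !(shomX hf) (shomS hf).
  exists k0 => k k0k; rewrite -nrm_cstar (word_column_inner hs) (range_projE ht).
  by rewrite (le_trans (hk0 k k0k)) // lerMn2r; apply/orP; right; lra.
have dd n : star d * d = range_proj t1 n * (star d * d) * range_proj t1 n.
  by rewrite -[in LHS](dP n) starM range_proj_star !mulrA.
suff E0 : E (star d * d) = 0.
  have : star d * d = 0 by apply: fE => //; exists d.
  move=> h; apply: nrm0_eq; apply/eqP; rewrite -sqrf_eq0 -nrm_cstar h nrm0.
  exact: eqxx.
(* The isometries [W] are now built from [v] and [t2]. They asymptotically commute with the range of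
   [Phi], which contains [E (star d * d)] because [B] lies in the range of [lam]. *)
apply: (asym_central_range_vanish hvt t1E).
  have [x xO <-] := Blam _ (cond_exp_in hE (star d * d)); rewrite -Phi_lam //.
  by apply: (asym_central_hom hvt t1E hf (v := u) (t := s2)) => //; rewrite (Q2_gen hQ).
move=> n n0; have BP : B (range_proj t1 n).
  have := PB n n0; rewrite -[Q2_s1 u s2]/(u * s2) -s1E -Phi_lam.
    by rewrite (shomM hf) !(shomX hf) (shomS hf).
  exact: cstar_genM (cstar_genX n O1) (cstar_genX n (cstar_gen_star O1)).
(* The bimodule property takes the projections out of [E], where the extra factor is absorbed by
   idempotence, and then puts them back. *)
rewrite {1}(dd n) (cond_exp_bimod hE) // -mulrA.
rewrite -{2}(range_proj_star t1 n) (range_projE ht) -(cond_exp_bimod hE) //.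
by rewrite -dd.
Qed.
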